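(* Let $(\Sigma,\partial)$ be a differential field whose field of constants $\mathbf{C}$ is algebraically closed and of characteristic zero. Let $P,Q\in\Sigma[\partial]\setminus\mathbf{C}[\partial]$ be commuting differential operators, both of positive order, let $h=\partial\mathrm{Res}(P-\lambda,Q-\mu)$ and let $f=\sqrt{h}$ be the square-free part of $h$. Then: 1. The radical of the elimination ideal $\mathcal{E}_{\mathbf{C}}(P-\lambda,Q-\mu)$ equals $\mathrm{BC}(P,Q)=(f)$. 2. The radical of the elimination ideal $\mathcal{E}(P-\lambda,Q-\mu)$ equals $[f]$.
   Context: $\Sigma[\partial]$ is the ring of differential operators with coefficients in $\Sigma$ ($\partial a=a\partial+\partial(a)$). $\lambda,\mu$ are algebraic variables over $\Sigma$ with $\partial(\lambda)=\partial(\mu)=0$, so $\Sigma[\lambda,\mu]$ is a differential ring with ring of constants $\mathbf{C}[\lambda,\mu]$. $(f)$ is the ideal generated by $f$ in $\mathbf{C}[\lambda,\mu]$, and $[f]$ is the differential ideal generated by $f$ in $\Sigma[\lambda,\mu]$. Burchnall–Chaundy ideal: $\mathrm{BC}(P,Q)=\{g\in\mathbf{C}[\lambda,\mu]\mid g(P,Q)=0\}$, the kernel of the ring homomorphism $\mathbf{C}[\lambda,\mu]\to\Sigma[\partial]$, $\lambda\mapsto P$, $\mu\mapsto Q$. Differential resultant: for operators $A,B$ of orders $n,m$ with coefficients in a differential domain $\mathbb{D}$, $\partial\mathrm{Res}(A,B)$ is the determinant of the $(n+m)\times(n+m)$ matrix whose rows are the coefficients, with respect to $\partial^{n+m-1},\dots,\partial,1$,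 of $\partial^{m-1}A,\dots,\partial A,A,\partial^{n-1}B,\dots,\partial B,B$. Here $\mathbb{D}=\Sigma[\lambda,\mu]$. Elimination ideals: let $(P-\lambda,Q-\mu)=\{C(P-\lambda)+D(Q-\mu)\mid C,D\in\Sigma[\lambda,\mu][\partial]\}$. Then $\mathcal{E}(P-\lambda,Q-\mu)=(P-\lambda,Q-\mu)\cap\Sigma[\lambda,\mu]$ (an ideal of $\Sigma[\lambda,\mu]$) and $\mathcal{E}_{\mathbf{C}}(P-\lambda,Q-\mu)=(P-\lambda,Q-\mu)\cap\mathbf{C}[\lambda,\mu]$ (an ideal of $\mathbf{C}[\lambda,\mu]$). *)

(* Defs.v *)
From HB Require Import structures.
From mathcomp Require Import all_boot all_order all_algebra.

Set Implicit Arguments.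
Unset Strict Implicit.
Unset Printing Implicit Defensive.

Import GRing.Theory.
Local Open Scope ring_scope.

HB.mixin Record hasDerivation R of GRing.ComNzRing R := {
  der : R -> R;
  derD : forall a b : R, der (a + b) = der a + der b;
  derM : forall a b : R, der (a * b) = der a * b + a * der b
}.

#[short(type="diffRingType")]
HB.structure Definition DiffRing :=
  {R of GRing.ComNzRing R & hasDerivation R}.

#[short(type="diffFieldType")]
HB.structure Definition DiffField :=
  {F of GRing.Field F & DiffRing F}.

Lemma der_semi_additive (R : diffRingType) : nmod_morphism (@der R).
Proof.
split; last exact: derD.
by apply: (@addrI _ (@der R 0)); rewrite -derD !addr0.
Qed.

HB.instance Definition _ (R : diffRingType) :=
  GRing.isNmodMorphism.Build R R (@der R) (@der_semi_additive R).

Lemma der1 (R : diffRingType) : der (1 : R) = 0.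
Proof. by apply: (@addrI _ (der (1 : R))); rewrite addr0 -{3}[1]mulr1 derM
  mulr1 mul1r. Qed.

(* The extension of the derivation to polynomials with der 'X = 0. Applied     *)
(* twice it makes {poly {poly R}} the differential ring R[lambda, mu].          *)
Section PolyDer.
Variable R : diffRingType.
Implicit Types p q : {poly R}.

Definition poly_der p : {poly R} := map_poly (@der R) p.

Lemma poly_derD p q : poly_der (p + q) = poly_der p + poly_der q.
Proof. exact: raddfD. Qed.

Lemma poly_derM p q : poly_der (p * q) = poly_der p * q + p * poly_der q.
Proof.
apply/polyP=> i; rewrite coef_map !(coefD, coefM) raddf_sum -big_split /=.
by apply: eq_bigr => j _; rewrite derM !coef_map.
Qed.

HB.instance Definition _ := hasDerivation.Build {poly R} poly_derD poly_derM.

Lemma coef_der p i : (der p)`_i = der p`_i.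
Proof. exact: coef_map. Qed.

Lemma derC (a : R) : der a%:P = (der a)%:P.
Proof. exact: map_polyC. Qed.
End PolyDer.

(* The field of constants. *)
Definition is_const (F : diffFieldType) : {pred F} := fun x => der x == 0.

Section Constants.
Variable F : diffFieldType.

Lemma is_const_divring : divring_closed (@is_const F).
Proof.
split=> [|x y|x y]; rewrite !unfold_in /=; first by rewrite der1.
  by move=> /eqP dx /eqP dy; rewrite raddfB /= dx dy subr0.
move=> /eqP dx /eqP dy; rewrite derM dx mul0r add0r.
have [->|y0] := eqVneq y 0; first by rewrite invr0 raddf0 mulr0.
have: der (y / y) = 0 by rewrite divff // der1.
rewrite derM dy mul0r add0r => /eqP.
by rewrite mulf_eq0 (negPf y0) /= => /eqP ->; rewrite mulr0.
Qed.

HB.instance Definition _ :=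
  GRing.isDivringClosed.Build F (@is_const F) is_const_divring.

Record constants := Const { cval : F; _ : cval \in @is_const F }.

HB.instance Definition _ := [isSub for cval].
HB.instance Definition _ := [Choice of constants by <:].
HB.instance Definition _ := [SubChoice_isSubComUnitRing of constants by <:].
HB.instance Definition _ :=
  [SubComUnitRing_isSubIntegralDomain of constants by <:].
HB.instance Definition _ := [SubIntegralDomain_isSubField of constants by <:].
End Constants.

(* Differential operators sum_i a_i D^i, stored through their polynomial of    *)
(* left coefficients. Composition is determined by D o (sum_i b_i D^i) =        *)
(* sum_i b_i D^(i+1) + sum_i der(b_i) D^i, which is dshift.                     *)
Record diffop (R : diffRingType) := DiffOp { dcoefs : {poly R} }.

Section DiffOp.
Variable R : diffRingType.
Implicit Types A B C : diffop R.
Implicit Types p q r : {poly R}.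

HB.instance Definition _ := [isNew for @dcoefs R].
HB.instance Definition _ := [Choice of diffop R by <:].

Definition dzero : diffop R := DiffOp 0.
Definition dopp A := DiffOp (- dcoefs A).
Definition dadd A B := DiffOp (dcoefs A + dcoefs B).

Lemma dcoefs_inj : injective (@dcoefs R).
Proof. exact: val_inj. Qed.

Lemma daddA : associative dadd.
Proof. by move=> A B C; apply: dcoefs_inj; rewrite /= addrA. Qed.
Lemma daddC : commutative dadd.
Proof. by move=> A B; apply: dcoefs_inj; rewrite /= addrC. Qed.
Lemma dadd0 : left_id dzero dadd.
Proof. by move=> A; apply: dcoefs_inj; rewrite /= add0r. Qed.
Lemma daddN : left_inverse dzero dopp dadd.
Proof. by move=> A; apply: dcoefs_inj; rewrite /= addNr. Qed.

HB.instance Definition _ :=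
  GRing.isZmodule.Build (diffop R) daddA daddC dadd0 daddN.

Definition dshift p : {poly R} := p * 'X + der p.

Definition pmul p q : {poly R} := \sum_(i < size p) p`_i *: iter i dshift q.

Lemma dshiftD p q : dshift (p + q) = dshift p + dshift q.
Proof. by rewrite /dshift mulrDl derD addrACA. Qed.

Lemma dshift0 : dshift 0 = 0.
Proof. by rewrite /dshift mul0r raddf0 addr0. Qed.

Lemma dshift_sum n (f : 'I_n -> {poly R}) :
  dshift (\sum_i f i) = \sum_i dshift (f i).
Proof. exact: (big_morph _ dshiftD dshift0). Qed.

Lemma dshiftZ a p : dshift (a *: p) = a *: dshift p + der a *: p.
Proof.
rewrite /dshift -!mul_polyC derM mulrDr -!mulrA -addrA; congr (_ + _).
by rewrite addrC derC.
Qed.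

Lemma iter_dshiftD i p q :
  iter i dshift (p + q) = iter i dshift p + iter i dshift q.
Proof. by elim: i => //= i ->; rewrite dshiftD. Qed.

Lemma iter_dshift0 i : iter i dshift 0 = 0.
Proof. by elim: i => //= i ->; rewrite dshift0. Qed.

Lemma pmul_wide n p q :
  (size p <= n)%N -> pmul p q = \sum_(i < n) p`_i *: iter i dshift q.
Proof.
move=> le_pn; rewrite /pmul (big_ord_widen n (fun i => p`_i *: iter i dshift q) le_pn).
rewrite big_mkcond; apply: eq_bigr => i _; case: ltnP => // h.
by rewrite nth_default // scale0r.
Qed.

Lemma pmulDl p q r : pmul (p + q) r = pmul p r + pmul q r.
Proof.
pose n := maxn (size p) (size q).
rewrite !(@pmul_wide n) ?leq_maxl ?leq_maxr ?size_polyD //.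
by rewrite -big_split; apply: eq_bigr => i _; rewrite coefD scalerDl.
Qed.

Lemma pmulDr p q r : pmul p (q + r) = pmul p q + pmul p r.
Proof.
by rewrite -big_split; apply: eq_bigr => i _; rewrite iter_dshiftD scalerDr.
Qed.

Lemma pmul0l q : pmul 0 q = 0.
Proof. by rewrite /pmul size_poly0 big_ord0. Qed.

Lemma pmulZl a p q : pmul (a *: p) q = a *: pmul p q.
Proof.
rewrite (@pmul_wide (size p)) ?size_scale_leq // scaler_sumr.
by apply: eq_bigr => i _; rewrite coefZ scalerA.
Qed.

Lemma pmul_dshift p q : pmul (dshift p) q = dshift (pmul p q).
Proof.
have hp : (size (dshift p) <= (size p).+1)%N.
  apply: leq_trans (size_polyD _ _) _; rewrite geq_max.
  rewrite (leq_trans (size_polyMleq _ _)) ?size_polyX ?addn2 //=.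
  by rewrite (leq_trans (size_poly _ _)).
rewrite (pmul_wide _ hp) dshift_sum.
under [RHS]eq_bigr => i _ do rewrite dshiftZ.
rewrite big_split /=.
under eq_bigr => i _ do rewrite coefD coefMX coef_der scalerDl.
rewrite big_split /=; congr (_ + _).
  by rewrite big_ord_recl /= scale0r add0r; apply: eq_bigr.
by rewrite big_ord_recr /= nth_default // raddf0 scale0r addr0.
Qed.

Lemma pmul_iter i p q : pmul (iter i dshift p) q = iter i dshift (pmul p q).
Proof. by elim: i => //= i <-; rewrite pmul_dshift. Qed.

Lemma pmulA : associative pmul.
Proof.
move=> p q r; rewrite [pmul p q]/pmul.
rewrite (big_morph (pmul^~ r) (fun x y => pmulDl x y r) (pmul0l r)).
by apply: eq_bigr => i _; rewrite pmulZl pmul_iter.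
Qed.

Lemma pmul1l : left_id 1 pmul.
Proof. by move=> p; rewrite /pmul size_poly1 big_ord1 coef1 scale1r. Qed.

Lemma dshiftXn i : dshift 'X^i = 'X^(i.+1).
Proof.
rewrite /dshift -exprSr; apply/polyP=> j.
rewrite coefD coef_der [X in der X]coefXn -[RHS]addr0; congr (_ + _).
by case: (_ == _); rewrite /= ?der1 ?raddf0.
Qed.

Lemma pmul1r : right_id 1 pmul.
Proof.
move=> p; rewrite -[RHS]coefK poly_def; apply: eq_bigr => i _.
by congr (_ *: _); elim: (i : nat) => //= j ->; rewrite dshiftXn.
Qed.

Definition done_ : diffop R := DiffOp 1.
Definition dmul A B := DiffOp (pmul (dcoefs A) (dcoefs B)).

Lemma dmulA : associative dmul.
Proof. by move=> A B C; apply: dcoefs_inj; rewrite /= pmulA. Qed.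
Lemma dmul1l : left_id done_ dmul.
Proof. by move=> A; apply: dcoefs_inj; rewrite /= pmul1l. Qed.
Lemma dmul1r : right_id done_ dmul.
Proof. by move=> A; apply: dcoefs_inj; rewrite /= pmul1r. Qed.
Lemma dmulDl : left_distributive dmul dadd.
Proof. by move=> A B C; apply: dcoefs_inj; rewrite /= pmulDl. Qed.
Lemma dmulDr : right_distributive dmul dadd.
Proof. by move=> A B C; apply: dcoefs_inj; rewrite /= pmulDr. Qed.
Lemma done_neq0 : done_ != dzero.
Proof. by apply/eqP=> /(congr1 (@dcoefs R)) /eqP; rewrite /= oner_eq0. Qed.

HB.instance Definition _ := GRing.Zmodule_isNzRing.Build (diffop R)
  dmulA dmul1l dmul1r dmulDl dmulDr done_neq0.

Definition opX : diffop R := DiffOp 'X.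
Definition opC (a : R) : diffop R := DiffOp a%:P.

Lemma opX_opC a : opX * opC a = opC a * opX + opC (der a).
Proof.
apply: dcoefs_inj => /=.
rewrite /pmul size_polyX size_polyC big_ord_recl big_ord1 /= !coefX /=.
rewrite scale0r add0r scale1r /dshift derC; congr (_ + _); case: eqVneq => [->|a0] /=; first by rewrite big_ord0 mul0r.
by rewrite big_ord1 coefC mul_polyC.
Qed.

Definition dorder A : nat := (size (dcoefs A)).-1.
End DiffOp.

(* The differential resultant, det of the coefficient rows of D^(m-1) A, ...,  *)
(* D A, A, D^(n-1) B, ..., D B, B with respect to D^(n+m-1), ..., D, 1, where   *)
(* n and m are the orders of A and B.                                           *)
Definition dres (R : diffRingType) (A B : diffop R) : R :=
  let n := dorder A in let m := dorder B in
  \det (col_mx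
    (\matrix_(i < m, j < m + n) (dcoefs (opX R ^+ rev_ord i * A))`_(rev_ord j))
    (\matrix_(i < n, j < m + n) (dcoefs (opX R ^+ rev_ord i * B))`_(rev_ord j))).

(* lambda is the inner variable and mu the outer one. *)
Notation bipoly R := {poly {poly R}}.

Section SpectralProblem.
Variable F : diffFieldType.
Notation C := (constants F).
Implicit Types (P Q : diffop F) (A B : diffop (bipoly F)).

Definition bivar_val (g : bipoly C) : bipoly F :=
  map_poly (map_poly (@cval F)) g.

Definition op_lift P : diffop (bipoly F) :=
  DiffOp (map_poly (fun a : F => a%:P%:P) (dcoefs P)).

Definition minus_lambda P : diffop (bipoly F) := op_lift P - opC ('X%:P).
Definition minus_mu Q : diffop (bipoly F) := op_lift Q - opC 'X.

(* Membership in C[D]. *)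
Definition const_coefs P : Prop := forall i, (dcoefs P)`_i \in @is_const F.

(* g(P, Q) = sum_(i, j) g_ij P^i Q^j. *)
Definition op_eval P Q (g : bipoly C) : diffop F :=
  (map_poly (fun p : {poly C} =>
     (map_poly (fun c : C => opC (cval c)) p).[P]) g).[Q].

Definition BC P Q (g : bipoly C) : Prop := op_eval P Q g = 0.

Definition elim_ideal A B (g : bipoly F) : Prop :=
  exists U V : diffop (bipoly F), opC g = U * A + V * B.

Definition elim_idealC A B (g : bipoly C) : Prop := elim_ideal A B (bivar_val g).
End SpectralProblem.

Definition radical (R : comNzRingType) (I : R -> Prop) (g : R) : Prop :=
  exists2 k : nat, (0 < k)%N & I (g ^+ k).

Definition principal_ideal (R : comNzRingType) (f g : R) : Prop :=
  exists q : R, g = q * f.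

Record differential_ideal (R : diffRingType) (I : R -> Prop) : Prop := {
  dideal0 : I 0;
  didealD : forall a b, I a -> I b -> I (a + b);
  didealM : forall a b, I b -> I (a * b);
  dideal_der : forall a, I a -> I (der a)
}.

Definition gen_dideal (R : diffRingType) (f g : R) : Prop :=
  forall I : R -> Prop, differential_ideal I -> I f -> I g.

Definition irreducible_elt (R : idomainType) (p : R) : Prop :=
  [/\ p != 0, p \isn't a GRing.unit
    & forall a b : R, p = a * b -> a \is a GRing.unit \/ b \is a GRing.unit].

Definition associated (R : idomainType) (p q : R) : Prop :=
  exists2 u : R, u \is a GRing.unit & p = u * q.

Definition square_free_part (R : idomainType) (h f : R) : Prop :=
  exists (k : nat) (p : 'I_k -> R) (e : 'I_k -> nat) (u v : R),
    [/\ u \is a GRing.unit /\ v \is a GRing.unit,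
        forall i, irreducible_elt (p i) /\ (0 < e i)%N,
        forall i j, i != j -> ~ associated (p i) (p j),
        h = u * \prod_i p i ^+ e i
      & f = v * \prod_i p i].

(* The resultant of P - lambda and Q - mu has constant coefficients only up to *)
(* a unit of F[lambda, mu]: when P and Q are not monic it is a power of the     *)
(* leading coefficient of P times a polynomial over the constants, as in        *)
(* dres (x D - lambda) (x D - mu) = x (lambda - mu).                            *)
Definition const_square_free_part (F : diffFieldType) (h : bipoly F)
    (f : bipoly (constants F)) : Prop :=
  exists (a : F) (h0 : bipoly (constants F)),
    [/\ a != 0, h = a%:P%:P * bivar_val h0 & square_free_part h0 f].

(* Main.v *)
Require Import Defs.
From HB Require Import structures.
From Stdlib Require Import Classical_Prop.
From mathcomp Require Import all_boot all_order all_algebra.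
From mathcomp Require Import perm.
Import GRing.Theory.
Local Open Scope ring_scope.

Set Implicit Arguments.
Unset Strict Implicit.
Unset Printing Implicit Defensive.

(** Let [A = P - lambda], an operator with coefficients in [F[lambda]], of order
    [n] and with invertible leading coefficient. Right division by [A] makes
    [1, D, ..., D^(n-1)] a basis of [F[lambda][D]] modulo the left multiples of
    [A]. Right multiplication by [Q] acts on this quotient because [Q] commutes
    with [A]; let [M] be its matrix. Row reduction of the resultant by the rows of
    [A] shows that [h] is, up to a nonzero factor in [F], the characteristic
    polynomial [chi] of [M] in the variable [mu] ([dres_char_poly]). Left
    multiplication by [D] commutes with right multiplication by [Q], which gives a
    Lax equation [der M = N M - M N]; by Jacobi's formula [chi] has constant
    coefficients ([der_char_poly]).

    The elimination ideal is the kernel of the evaluation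
    [sum a_ij lambda^i mu^j |-> sum a_ij P^i Q^j] ([elim_idealE]). On constant
    coefficients this is the evaluation that defines [BC], a ring morphism into a
    domain, so [BC] is prime and the elimination ideal over the constants is
    already radical. By Cayley-Hamilton [chi] lies in [BC]. Conversely, if [g] is
    in [BC] then [g(M) = 0], so [mu - M] divides the scalar matrix [g], and taking
    determinants [chi] divides [g^n] ([char_poly_dvd_annihilator]).

    It follows by Gauss's lemma that [BC] is generated by a monic irreducible
    polynomial [d] and that [chi] is a power of [d] ([ker_principal]); the
    square-free part of [h] is thus associated with [d].

    Over [F], two operators of the same order that commute with [P] have leading
    coefficients with a constant ratio, so operators in the centralizer of [P]
    that are independent over the constants are independent over [F]
    ([centralizer_free]). Hence the elimination ideal over [F] is also generated
    by [d] ([elim_ideal_principal]). It is radical because [d], being irreducible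
    in characteristic zero, is coprime to its derivative in [mu], and this persists
    over [F] ([dvdp_exp_separable]). The multiples of [d] form a differential ideal
    since [d] has derivative zero. *)

(** * Products and right division of differential operators *)

Section Operators.
Variable R : diffRingType.
Implicit Types (X Y Z A : diffop R) (p q : {poly R}) (a b : R).

Lemma dcoefsD X Y : dcoefs (X + Y) = dcoefs X + dcoefs Y. Proof. by []. Qed.
Lemma dcoefsN X : dcoefs (- X) = - dcoefs X. Proof. by []. Qed.

Lemma dcoefs_is_additive : zmod_morphism (@dcoefs R).
Proof. by move=> X Y; rewrite dcoefsD dcoefsN. Qed.
HB.instance Definition _ :=
  GRing.isZmodMorphism.Build (diffop R) {poly R} (@dcoefs R) dcoefs_is_additive.

Lemma dcoefs_sum I (r : seq I) (C : pred I) (G : I -> diffop R) :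
  dcoefs (\sum_(i <- r | C i) G i) = \sum_(i <- r | C i) dcoefs (G i).
Proof. exact: raddf_sum. Qed.

Lemma dcoefs_opCM a X : dcoefs (opC a * X) = a *: dcoefs X.
Proof. by rewrite /= -[a%:P]mulr1 mul_polyC pmulZl pmul1l. Qed.

Lemma dcoefs_opXM X : dcoefs (opX R * X) = dshift (dcoefs X).
Proof. by rewrite /= -['X](dshiftXn R 0) pmul_dshift pmul1l. Qed.

Lemma dcoefs_opXnM i X : dcoefs (opX R ^+ i * X) = iter i (@dshift R) (dcoefs X).
Proof. by elim: i => [|i IH]; [rewrite mul1r | rewrite exprS -mulrA dcoefs_opXM IH]. Qed.

Lemma dcoefs_opXn i : dcoefs (opX R ^+ i) = 'X^i.
Proof.
rewrite -[opX R ^+ i]mulr1 dcoefs_opXnM /=.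
by elim: i => //= i ->; rewrite dshiftXn.
Qed.

Lemma opC_is_additive : zmod_morphism (@opC R).
Proof. by move=> a b; apply: dcoefs_inj; rewrite dcoefsD dcoefsN /= polyCB. Qed.
HB.instance Definition _ :=
  GRing.isZmodMorphism.Build R (diffop R) (@opC R) opC_is_additive.

Lemma opC_is_multiplicative : monoid_morphism (@opC R).
Proof.
split=> [|a b]; apply: dcoefs_inj => //.
by rewrite dcoefs_opCM /= polyCM mul_polyC.
Qed.
HB.instance Definition _ :=
  GRing.isMonoidMorphism.Build R (diffop R) (@opC R) opC_is_multiplicative.

Lemma diffop_expand n X : (size (dcoefs X) <= n)%N ->
  X = \sum_(i < n) opC (dcoefs X)`_i * opX R ^+ i.
Proof.
move=> le_Xn; apply: dcoefs_inj; rewrite dcoefs_sum.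
transitivity (\sum_(i < n) (dcoefs X)`_i *: 'X^i).
  rewrite -poly_def; apply/polyP=> i; rewrite coef_poly.
  by case: ltnP => // le_ni; rewrite nth_default // (leq_trans le_Xn).
by apply: eq_bigr => i _; rewrite dcoefs_opCM dcoefs_opXn.
Qed.

Lemma dshiftZ_const a p : der a = 0 -> dshift (a *: p) = a *: dshift p.
Proof. by move=> da; rewrite dshiftZ da scale0r addr0. Qed.

Lemma opC_central a X : der a = 0 -> opC a * X = X * opC a.
Proof.
move=> da; apply: dcoefs_inj; rewrite dcoefs_opCM -{1}[X]mulr1 /= /dmul /= /pmul.
rewrite scaler_sumr; apply: eq_bigr => i _; rewrite scalerA mulrC -scalerA.
congr (_ *: _); rewrite -[a%:P]mulr1 mul_polyC.
by elim: (i : nat) => //= j <-; rewrite dshiftZ_const.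
Qed.

Lemma size_iter_dshift i m q : (size q <= m)%N ->
  (size (iter i (@dshift R) q) <= i + m)%N.
Proof.
move=> le_qm; elim: i => //= i IH; rewrite addSn.
apply: leq_trans (size_polyD _ _) _; rewrite geq_max.
rewrite (leq_trans (size_polyMleq _ _)) ?size_polyX ?addn2 //=.
exact: leq_trans (size_poly _ _) (leqW IH).
Qed.

Lemma coef_dshift q j : (dshift q)`_j = (q * 'X)`_j + der q`_j.
Proof. by rewrite coefD coef_der. Qed.

Lemma coef_iter_dshift i m q : (size q <= m.+1)%N ->
  (iter i (@dshift R) q)`_(i + m) = q`_m.
Proof.
move=> le_qm; elim: i => //= i IH.
rewrite coef_dshift coefMX /= IH [X in der X]nth_default ?raddf0 ?addr0 //.
by rewrite (leq_trans (size_iter_dshift i le_qm)) // addnS.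
Qed.

(** In [D ^ i.+1 * b D ^ m] the derivation reaches the coefficient just below the
    top once for each of the [i.+1] factors [D]. *)
Lemma coef_iter_dshift_sub i m q : (size q <= m.+1)%N ->
  (iter i.+1 (@dshift R) q)`_(i + m) = (q * 'X)`_m + (der q`_m) *+ i.+1.
Proof.
move=> le_qm; elim: i => [|i IH]; first by rewrite coef_dshift.
have := coef_iter_dshift i.+1 le_qm; move: IH.
rewrite -[iter i.+2 _ _]/(dshift (iter i.+1 _ _)); set u := iter i.+1 _ _ => IH top.
by rewrite coef_dshift top coefMX addSn /= IH -addrA -mulrSr.
Qed.

Lemma size_pmul n m p q : (size p <= n.+1)%N -> (size q <= m)%N ->
  (size (pmul p q) <= n + m)%N.
Proof.
move=> le_pn le_qm; rewrite (pmul_wide _ le_pn).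
apply: (leq_trans (size_sum _ _ _)); apply/bigmax_leqP => i _.
apply: leq_trans (size_scale_leq _ _) _.
by rewrite (leq_trans (size_iter_dshift i le_qm)) // leq_add2r -ltnS.
Qed.

Lemma coef_pmul_top n m p q : (size p <= n.+1)%N -> (size q <= m.+1)%N ->
  (pmul p q)`_(n + m) = p`_n * q`_m.
Proof.
move=> le_pn le_qm; rewrite (pmul_wide _ le_pn) coef_sum big_ord_recr /=.
rewrite coefZ coef_iter_dshift // big1 ?add0r // => i _.
rewrite coefZ [X in _ * X]nth_default ?mulr0 //.
by rewrite (leq_trans (size_iter_dshift i le_qm)) // addnS -addSn leq_add2r.
Qed.

Lemma coef_pmul_sub n m p q : (size p <= n.+2)%N -> (size q <= m.+1)%N ->
  (pmul p q)`_(n + m) =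
    p`_n.+1 * ((q * 'X)`_m + (der q`_m) *+ n.+1) + p`_n * q`_m.
Proof.
move=> le_pn le_qm; rewrite (pmul_wide _ le_pn) coef_sum 2!big_ord_recr.
rewrite ![X in X + _ = _]/= !coefZ coef_iter_dshift // coef_iter_dshift_sub //.
rewrite big1 ?add0r 1?addrC // => i _ /=.
rewrite coefZ [X in _ * X]nth_default ?mulr0 //.
by rewrite (leq_trans (size_iter_dshift i le_qm)) // addnS -addSn leq_add2r.
Qed.

Section Division.
Variables (n : nat) (A : diffop R) (b : R).
Hypotheses (sizeA : (size (dcoefs A) <= n.+1)%N) (bA : b * (dcoefs A)`_n = 1).

Lemma div_order_lt m X : (size (dcoefs X) <= m + n)%N ->
  exists Y Z, [/\ (size (dcoefs Y) <= m)%N, (size (dcoefs Z) <= n)%N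
                & X = Y * A + Z].
Proof.
elim: m X => [|m IH] X leX.
  by exists 0, X; split; rewrite ?size_poly0 // mul0r add0r.
pose T := opC ((dcoefs X)`_(m + n) * b) * opX R ^+ m.
have szT : (size (dcoefs T) <= m.+1)%N.
  by rewrite dcoefs_opCM dcoefs_opXn (leq_trans (size_scale_leq _ _)) ?size_polyXn.
have [|Y [Z [leY leZ eX]]] := IH (X - T * A).
  apply/leq_sizeP=> j; rewrite leq_eqVlt dcoefsD dcoefsN coefB => /orP[/eqP<-|lt_j].
    rewrite (coef_pmul_top szT sizeA) dcoefs_opCM dcoefs_opXn coefZ coefXn eqxx.
    by rewrite mulr1 -mulrA bA mulr1 subrr.
  rewrite !nth_default ?subr0 //; last exact: leq_trans leX _.
  by rewrite (leq_trans (size_pmul szT sizeA)) // addnS.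
exists (Y + T), Z; split => //; last by rewrite mulrDl addrAC -eX subrK.
by rewrite (leq_trans (size_polyD _ _)) // geq_max leqW.
Qed.

Lemma order_ltM_eq0 X : (size (dcoefs (X * A)%R) <= n)%N -> X = 0.
Proof.
move=> leXA; apply/eqP; apply: contraTT isT => X0.
have : (0 < size (dcoefs X))%N.
  by rewrite size_poly_gt0; apply: contra X0 => /eqP e; apply/eqP; apply: dcoefs_inj.
case e: (size (dcoefs X)) => [//|k] _.
have : (dcoefs (X * A))`_(k + n) * b = 0.
  by rewrite nth_default ?mul0r // (leq_trans leXA) ?leq_addl.
rewrite coef_pmul_top ?e // -mulrA [_ * b]mulrC bA mulr1 => X_k0.
have := lead_coef_eq0 (dcoefs X).
by rewrite lead_coefE e X_k0 eqxx -size_poly_eq0 e.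
Qed.
End Division.
End Operators.

(** * Adjoining a constant variable and evaluating it at an operator *)

Section ConstantVariable.
Variable R : diffRingType.
Implicit Types (X Y Z : diffop R) (W : diffop {poly R}) (p q : {poly R}).

Lemma derX : der ('X : {poly R}) = 0.
Proof.
apply/polyP=> i; rewrite coef_der coefX coef0.
by case: (_ == _); rewrite ?der1 ?raddf0.
Qed.

Definition oplift X : diffop {poly R} := DiffOp (map_poly polyC (dcoefs X)).

Lemma map_polyC_dshift p : map_poly polyC (dshift p) = dshift (map_poly polyC p).
Proof.
rewrite /dshift rmorphD rmorphM /= map_polyX; congr (_ + _).
by apply/polyP=> i; rewrite coef_map !coef_der coef_map derC.
Qed.

Lemma map_polyC_iter_dshift i p :
  map_poly polyC (iter i (@dshift R) p) =
  iter i (@dshift {poly R}) (map_poly polyC p).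
Proof. by elim: i => //= i <-; rewrite map_polyC_dshift. Qed.

Lemma oplift_is_additive : zmod_morphism oplift.
Proof. by move=> X Y; apply: dcoefs_inj; rewrite /= rmorphB. Qed.
HB.instance Definition _ := GRing.isZmodMorphism.Build
  (diffop R) (diffop {poly R}) oplift oplift_is_additive.

Lemma oplift_is_multiplicative : monoid_morphism oplift.
Proof.
split=> [|X Y]; apply: dcoefs_inj; first by rewrite /= rmorph1.
rewrite /= [RHS](@pmul_wide _ (size (dcoefs X))) ?size_poly // rmorph_sum /=.
apply: eq_bigr => i _; rewrite -mul_polyC rmorphM /= map_polyC mul_polyC.
by rewrite map_polyC_iter_dshift coef_map.
Qed.
HB.instance Definition _ := GRing.isMonoidMorphism.Build
  (diffop R) (diffop {poly R}) oplift oplift_is_multiplicative.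

Lemma oplift_opC a : oplift (opC a) = opC a%:P.
Proof. by apply: dcoefs_inj; rewrite /= map_polyC. Qed.

Lemma oplift_opX : oplift (opX R) = opX {poly R}.
Proof. by apply: dcoefs_inj; rewrite /= map_polyX. Qed.

Lemma DiffOp_is_additive : zmod_morphism (@DiffOp R).
Proof. by []. Qed.
HB.instance Definition _ := GRing.isZmodMorphism.Build
  {poly R} (diffop R) (@DiffOp R) DiffOp_is_additive.

(** Since the added variable ['X] is central in the operators over [{poly R}],
    these are polynomials in ['X] over [diffop R], which can be evaluated at an
    operator written to the right of the coefficients. *)
Definition opev Z W : diffop R :=
  (map_poly (@DiffOp R) (swapXY (dcoefs W))).[Z].

Lemma opev_is_additive Z : zmod_morphism (opev Z).
Proof.
by move=> U W; rewrite /opev dcoefsD dcoefsN !raddfB /= hornerD hornerN.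
Qed.
HB.instance Definition _ Z := GRing.isZmodMorphism.Build
  (diffop {poly R}) (diffop R) (opev Z) (opev_is_additive Z).

Lemma opev_opC Z p : opev Z (opC p) = (map_poly (@opC R) p).[Z].
Proof.
rewrite /opev /= swapXY_polyC; congr _.[_].
by apply/polyP=> i; rewrite !coef_map.
Qed.

Lemma opevMX Z W : opev Z (W * opC 'X) = opev Z W * Z.
Proof.
rewrite -opC_central ?derX // /opev dcoefs_opCM -mul_polyC rmorphM /=.
rewrite swapXY_polyC map_polyX -hornerMX; congr _.[_].
by apply/polyP=> i; rewrite coef_map coefXM coefMX; case: eqP => _; rewrite ?raddf0 ?coef_map.
Qed.

Lemma swapXY_pmul (w : {poly {poly R}}) q j :
  (swapXY (pmul w (map_poly polyC q)))`_j = pmul (swapXY w)`_j q.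
Proof.
rewrite [RHS](@pmul_wide _ (size w)); last first.
  by apply/leq_sizeP=> i le_wi; rewrite coef_swapXY [w`_i]nth_default // coef0.
apply/polyP=> k; rewrite coef_swapXY !coef_sum; apply: eq_bigr => i _.
by rewrite !coefZ -map_polyC_iter_dshift coef_map coefMC coef_swapXY.
Qed.

Lemma opev_mul_oplift Z W Y : Y * Z = Z * Y ->
  opev Z (W * oplift Y) = opev Z W * Y.
Proof.
move=> YZ; transitivity (opev Z W * (Y%:P).[Z]); last by rewrite hornerC.
rewrite -hornerM_comm; last first.
  by rewrite /comm_poly hornerC.
congr _.[_]; apply/polyP=> j; rewrite coefMC !coef_map.
by apply: dcoefs_inj; rewrite /= swapXY_pmul.
Qed.

Lemma opev_mul_root Z W : opev Z (W * (oplift Z - opC 'X)) = 0.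
Proof. by rewrite mulrBr raddfB /= opev_mul_oplift // opevMX subrr. Qed.

Lemma opev_oplift Z Y : opev Z (oplift Y) = Y.
Proof.
rewrite /opev /= swapXY_map_polyC.
have -> : map_poly (@DiffOp R) (dcoefs Y)%:P = Y%:P by rewrite map_polyC; case: Y.
by rewrite hornerC.
Qed.

(** The variable is central, so that ['X ^ j - Z ^ j] is a left multiple of
    ['X - Z]; the powers of [D] stand to the left of those of ['X]. *)
Lemma opev_mod Z W : exists V,
  W - oplift (opev Z W) = V * (oplift Z - opC 'X).
Proof.
have base p Y : exists V, opC p * oplift Y - oplift (opev Z (opC p * oplift Y)) =
    V * (oplift Z - opC 'X).
  elim/poly_ind: p => [|p c [V eV]].
    by exists 0; rewrite raddf0 !mul0r raddf0 [oplift 0]raddf0 subrr.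
  have -> : opC (p * 'X + c%:P) * oplift Y =
      opC p * oplift Y * opC 'X + oplift (opC c * Y).
    rewrite [opC (_ + _)]rmorphD /= [opC (_ * _)]rmorphM /= mulrDl.
    rewrite [oplift (_ * _)]rmorphM /= oplift_opC -!mulrA.
    by rewrite (opC_central _ derX).
  rewrite [opev _ _]raddfD /= opevMX opev_oplift [oplift (_ + _)]raddfD /=.
  rewrite opprD addrACA subrr addr0 [oplift (_ * Z)]rmorphM /=.
  move: eV; set U := opC p * oplift Y; set T := oplift (opev _ _) => eV.
  exists (V * opC 'X - T).
  rewrite mulrBl -[V * _ * _]mulrA (opC_central _ derX) mulrA -eV.
  by rewrite mulrBl mulrBr opprB addrA subrK.
have -> : W = \sum_(i < size (dcoefs W)) opC (dcoefs W)`_i * oplift (opX R ^+ i).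
  rewrite {1}(diffop_expand (leqnn (size (dcoefs W)))); apply: eq_bigr => i _.
  by rewrite rmorphXn /= oplift_opX.
rewrite [opev _ _]raddf_sum [oplift _]raddf_sum -sumrB.
elim/big_ind: _ => [|U V [U' ->] [V' ->]|i _]; last exact: base.
  by exists 0; rewrite mul0r.
by exists (U' + V'); rewrite mulrDl.
Qed.
End ConstantVariable.

(** * Derivative of a determinant; row vectors as operators of bounded order *)

Section Jacobi.
Variable R : diffRingType.

Lemma der_prod (I : finType) (f : I -> R) :
  der (\prod_i f i) = \sum_i \prod_k (if k == i then der (f k) else f k).
Proof.
have main (r : seq I) : uniq r -> der (\prod_(i <- r) f i) =
    \sum_(i <- r) \prod_(k <- r) (if k == i then der (f k) else f k).
  elim: r => [|x r IH] /=; first by rewrite !big_nil der1.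
  case/andP=> xr ur; rewrite !big_cons derM IH //; congr (_ + _).
    rewrite eqxx; congr (_ * _); apply: eq_big_seq => k kr.
    by case: eqP kr xr => // -> ->.
  rewrite mulr_sumr; apply: eq_big_seq => i ir; rewrite big_cons.
  by case: eqP ir xr => // -> ->.
by rewrite main ?index_enum_uniq.
Qed.

(** Jacobi's formula: the derivative is a sum of determinants with one row
    differentiated, each of which is expanded along that row. *)
Lemma der_det n (G : 'M[R]_n) : der (\det G) = \tr (map_mx (@der R) G *m \adj G).
Proof.
pose H i := \matrix_(k, l) if k == i then der (G k l) else G k l.
transitivity (\sum_i \det (H i)).
  rewrite /determinant raddf_sum exchange_big /=; apply: eq_bigr => s _.
  rewrite -mulr_sumr -(signr_odd _ s) !mulr_sign.
  have -> : \sum_i \prod_k H i k (s k) = der (\prod_i G i (s i)).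
    rewrite der_prod; apply: eq_bigr => i _; apply: eq_bigr => k _.
    by rewrite mxE.
  by case: (odd _) => //; rewrite raddfN.
apply: eq_bigr => i _; rewrite (expand_det_row _ i) mxE; apply: eq_bigr => j _.
rewrite !mxE eqxx; congr (_ * _); congr (_ * \det _).
by apply/matrixP=> k l; rewrite !mxE eq_sym (negPf (neq_lift _ _)).
Qed.
End Jacobi.

Section RowOperators.
Variable R : diffRingType.
Implicit Types (n : nat) (X : diffop R).

(** The powers of [D] decrease along the row, as they do along the rows of the
    differential resultant. *)
Definition rowop n (v : 'rV[R]_n) : diffop R :=
  \sum_k opC (v 0 k) * opX R ^+ rev_ord k.

Lemma rowop_is_additive n : zmod_morphism (@rowop n).
Proof.
move=> u v; rewrite -sumrB; apply: eq_bigr => k _.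
by rewrite !mxE raddfB mulrBl.
Qed.
HB.instance Definition _ n := GRing.isZmodMorphism.Build
  'rV[R]_n (diffop R) (@rowop n) (@rowop_is_additive n).

Lemma opC_rowop n a (v : 'rV[R]_n) : opC a * rowop v = rowop (a *: v).
Proof.
by rewrite mulr_sumr; apply: eq_bigr => k _; rewrite !mxE rmorphM mulrA.
Qed.

Lemma coef_rowop n (v : 'rV[R]_n) k : (dcoefs (rowop v))`_(rev_ord k) = v 0 k.
Proof.
rewrite dcoefs_sum coef_sum (bigD1 k) // big1 => [|i /negPf ik].
  by rewrite dcoefs_opCM dcoefs_opXn coefZ coefXn eqxx mulr1; apply: addr0.
rewrite dcoefs_opCM dcoefs_opXn coefZ coefXn.
rewrite -[_ == _]/(rev_ord k == rev_ord i) (inj_eq rev_ord_inj) eq_sym ik.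
by rewrite mulr0.
Qed.

Lemma rowop0P n (v : 'rV[R]_n) : rowop v = 0 -> v = 0.
Proof. by move=> v0; apply/rowP=> k; rewrite -coef_rowop v0 coef0 mxE. Qed.

Lemma size_rowop n (v : 'rV[R]_n) : (size (dcoefs (rowop v)) <= n)%N.
Proof.
rewrite dcoefs_sum; apply: (leq_trans (size_sum _ _ _)).
apply/bigmax_leqP => k _.
rewrite dcoefs_opCM (leq_trans (size_scale_leq _ _)) //.
by rewrite dcoefs_opXn size_polyXn.
Qed.

Lemma rowop_expand n X : (size (dcoefs X) <= n)%N ->
  X = rowop (\row_k (dcoefs X)`_(rev_ord (k : 'I_n))).
Proof.
move=> leX; rewrite {1}(diffop_expand leX) (reindex_inj rev_ord_inj).
by apply: eq_bigr => k _; rewrite mxE.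
Qed.

Lemma rowop_mul m n (v : 'rV[R]_m) (M : 'M_(m, n)) :
  rowop (v *m M) = \sum_i opC (v 0 i) * rowop (row i M).
Proof.
rewrite mulmx_sum_row raddf_sum.
by apply: eq_bigr => i _; rewrite opC_rowop.
Qed.

Lemma rowop_delta n (k : 'I_n) :
  rowop (delta_mx 0 k) = opX R ^+ rev_ord k.
Proof.
rewrite /rowop (bigD1 k) //= big1 ?addr0 => [|i /negPf ik].
  by rewrite mxE !eqxx rmorph1 mul1r.
by rewrite mxE ik andbF raddf0 mul0r.
Qed.
End RowOperators.

Section Remainder.
Variables (R : diffRingType) (n : nat) (A : diffop R) (b : R).
Hypotheses (sizeA : (size (dcoefs A) <= n.+1)%N) (bA : b * (dcoefs A)`_n = 1).

Lemma rowop_mod_eq0 (v : 'rV[R]_n) X : rowop v = X * A -> v = 0.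
Proof.
move=> e; apply: rowop0P; rewrite e (order_ltM_eq0 sizeA bA (X := X)) ?mul0r //.
by rewrite -e size_rowop.
Qed.

Lemma div_rows k (I : finType) (f : I -> diffop R) :
  (forall i, size (dcoefs (f i)) <= k + n)%N ->
  exists X M, forall i, f i = rowop (X i : 'rV_k) * A + rowop (M i : 'rV_n).
Proof.
move=> szf; have /fin_all_exists2[X XP] : forall i, exists2 X : 'rV_k,
    True & exists M : 'rV_n, f i = rowop X * A + rowop M.
  move=> i; have [Y [Z [szY szZ ->]]] := div_order_lt sizeA bA (szf i).
  exists (\row_j (dcoefs Y)`_(rev_ord j)) => //; rewrite -rowop_expand //.
  by exists (\row_j (dcoefs Z)`_(rev_ord j)); rewrite -rowop_expand.
by move=> /fin_all_exists[M MP]; exists X, M.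
Qed.
End Remainder.

(** * The matrix of right multiplication by Q modulo A *)

(** For every [p] the matrix ['X - M] divides [p('X) - p(M)] on the left. When
    [p(M) = 0] this makes it a factor of the scalar matrix [p], of determinant
    [p ^+ n.+1]. *)
Lemma char_poly_dvd_annihilator (R : comNzRingType) n (M : 'M[R]_n.+1) p :
  horner_mx M p = 0 -> exists k, p ^+ n.+1 = k * char_poly M.
Proof.
have commM q : horner_mx M q * M = M * horner_mx M q.
  by rewrite -{2 3}[M]horner_mx_X -!rmorphM /= mulrC.
have [K] : exists K, p%:M - map_mx polyC (horner_mx M p) = char_poly_mx M * K.
  elim/poly_ind: p => [|p c [K eK]].
    by exists 0; rewrite mulr0 !raddf0 addr0.
  exists (K * 'X%:M + map_mx polyC (horner_mx M p)).
  have -> : (p * 'X + c%:P)%:M = p%:M * 'X%:M + (c%:P)%:M :> 'M_n.+1.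
    by rewrite raddfD /= scalar_mxM.
  rewrite rmorphD rmorphM /= horner_mx_X horner_mx_C.
  rewrite map_mxD map_scalar_mx opprD addrACA subrr addr0.
  rewrite mulrDr mulrA -eK map_mxM mulrBl.
  have -> : char_poly_mx M * map_mx polyC (horner_mx M p) =
     map_mx polyC (horner_mx M p) * 'X%:M -
     map_mx polyC (horner_mx M p) * map_mx polyC M.
    rewrite mulrBl; congr (_ - _); first by apply/esym/scalar_mxC.
    transitivity (map_mx polyC (M * horner_mx M p)); first by rewrite map_mxM.
    by rewrite -commM map_mxM.
  by rewrite addrA subrK.
move=> eK pM0; exists (\det K); rewrite mulrC -det_mulmx -[char_poly_mx M *m K]eK.
by rewrite pM0 map_mx0 subr0 det_scalar.
Qed.

Section Companion.
Variables (R : diffRingType) (n : nat) (A Q : diffop R) (b : R).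
Hypotheses (sizeA : (size (dcoefs A) <= n.+2)%N) (bA : b * (dcoefs A)`_n.+1 = 1).
Hypothesis AQ : A * Q = Q * A.

Definition eqmod X Y := exists W, X = W * A + Y.

Lemma eqmod_refl X : eqmod X X.
Proof. by exists 0; rewrite mul0r add0r. Qed.

Lemma eqmod_trans X Y Z : eqmod X Y -> eqmod Y Z -> eqmod X Z.
Proof. by move=> [U ->] [V ->]; exists (U + V); rewrite mulrDl addrA. Qed.

Lemma eqmodD X Y Z T : eqmod X Y -> eqmod Z T -> eqmod (X + Z) (Y + T).
Proof. by move=> [U ->] [V ->]; exists (U + V); rewrite mulrDl addrACA. Qed.

Lemma eqmod_sum (I : finType) (f g : I -> diffop R) :
  (forall i, eqmod (f i) (g i)) -> eqmod (\sum_i f i) (\sum_i g i).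
Proof.
move=> fg; elim/big_ind2: _ => //; first exact: eqmod_refl.
by move=> *; apply: eqmodD.
Qed.

Lemma eqmodMl T X Y : eqmod X Y -> eqmod (T * X) (T * Y).
Proof. by move=> [W ->]; exists (T * W); rewrite mulrDr mulrA. Qed.

Lemma eqmodMr X Y : eqmod X Y -> eqmod (X * Q) (Y * Q).
Proof. by move=> [W ->]; exists (W * Q); rewrite mulrDl -!mulrA AQ. Qed.

Lemma eqmod_rowop_inj X (u v : 'rV_n.+1) :
  eqmod X (rowop u) -> eqmod X (rowop v) -> u = v.
Proof.
move=> [U ->] [V e]; apply/eqP; rewrite -subr_eq0; apply/eqP.
apply: (rowop_mod_eq0 sizeA bA (X := V - U)).
by rewrite raddfB mulrBl; apply/eqP; rewrite subr_eq addrAC -e addrC addKr eqxx.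
Qed.

Variables M N : 'M[R]_n.+1.
Hypothesis MP : forall i, eqmod (opX R ^+ rev_ord i * Q) (rowop (row i M)).
Hypothesis NP : forall i, eqmod (opX R * opX R ^+ rev_ord i) (rowop (row i N)).

Lemma rowopMQ (v : 'rV_n.+1) : eqmod (rowop v * Q) (rowop (v *m M)).
Proof.
rewrite mulr_suml rowop_mul; apply: eqmod_sum => i.
by rewrite -mulrA; apply: eqmodMl.
Qed.

Lemma opX_rowop (v : 'rV_n.+1) :
  eqmod (opX R * rowop v) (rowop (v *m N + map_mx (@der R) v)).
Proof.
rewrite mulr_sumr raddfD /= rowop_mul -big_split /=.
apply: eqmod_sum => i; rewrite mulrA opX_opC mulrDl -mulrA mxE.
by apply: eqmodD; [apply: eqmodMl (NP i) | apply: eqmod_refl].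
Qed.

(** The Lax equation expresses that right multiplication by [Q] commutes with left
    multiplication by [D], which acts on row vectors as [v |-> v N + der v]. *)
Lemma der_companion : map_mx (@der R) M = N *m M - M *m N.
Proof.
apply/row_matrixP=> i; rewrite rowE -[LHS]addr0 -[RHS]addr0.
pose v : 'rV[R]_n.+1 := delta_mx 0 i.
have v' : map_mx (@der R) v = 0.
  by apply/rowP=> k; rewrite !mxE; case: (_ && _); rewrite /= ?der1 ?raddf0.
have : v *m M *m N + map_mx (@der R) (v *m M) = (v *m N + map_mx (@der R) v) *m M.
  apply: (@eqmod_rowop_inj (opX R * rowop v * Q)); last first.
    by apply: eqmod_trans (rowopMQ _); apply/eqmodMr/opX_rowop.
  rewrite -mulrA; apply: eqmod_trans (opX_rowop _).
  by apply/eqmodMl/rowopMQ.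
rewrite v' addr0 !addr0 [row i _]rowE mulmxBr !mulmxA => <-.
by rewrite addrC addKr -!rowE map_row.
Qed.

(** With [G = 'X - M] the Lax equation reads [der G = N G - G N], and the trace of
    [(N G - G N) adj(G)] vanishes. *)
Lemma der_char_poly : der (char_poly M) = 0.
Proof.
rewrite /char_poly der_det; set G := char_poly_mx M.
have -> : map_mx (@der _) G = map_mx polyC N *m G - G *m map_mx polyC N.
  rewrite /G /char_poly_mx mulmxBr mulmxBl scalar_mxC opprB [X in _ = _ + X]addrC.
  rewrite addrACA subrr add0r addrC -!map_mxM -map_mxB /= -[M *m N - _]opprB -der_companion.
  apply/matrixP=> i j; rewrite !mxE raddfB /= derC raddfMn /= derX mul0rn sub0r.
  by rewrite polyCN.
rewrite mulmxBl raddfB /= -!mulmxA mul_mx_adj [X in _ - X]mxtrace_mulC -mulmxA.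
by rewrite mul_adj_mx subrr.
Qed.

Lemma rowopMQn (v : 'rV_n.+1) k : eqmod (rowop v * Q ^+ k) (rowop (v *m (M ^+ k))).
Proof.
elim: k => [|k IH]; first by rewrite mulr1 mulmx1; apply: eqmod_refl.
rewrite !exprSr mulrA mulmxA; apply: eqmod_trans (rowopMQ _).
exact: eqmodMr.
Qed.

Lemma rowop_horner (v : 'rV_n.+1) (p : {poly R}) :
  eqmod (\sum_(i < size p) opC p`_i * (rowop v * Q ^+ i))
        (rowop (v *m horner_mx M p)).
Proof.
have -> : rowop (v *m horner_mx M p) =
    \sum_(i < size p) opC p`_i * rowop (v *m (M ^+ i)).
  rewrite -{1}[p]coefK poly_def rmorph_sum mulmx_sumr raddf_sum.
  apply: eq_bigr => i _; rewrite opC_rowop; congr rowop.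
  rewrite -mul_polyC rmorphM rmorphXn /= horner_mx_C horner_mx_X scalemxAr.
  by congr (_ *m _); apply: mul_scalar_mx.
by apply: eqmod_sum => i; apply/eqmodMl/rowopMQn.
Qed.

(** The last unit vector stands for [D ^ 0 = 1], so that modulo [A] the operator
    [Q ^ k] is the last row of [M ^ k], and Cayley-Hamilton applies. *)
Lemma char_poly_eval : eqmod (map_poly (@opC R) (char_poly M)).[Q] 0.
Proof.
have := rowop_horner (delta_mx 0 ord_max) (char_poly M).
rewrite Cayley_Hamilton mulmx0 raddf0 rowop_delta /= subnn expr0.
rewrite horner_poly; congr (eqmod _ _).
by apply: eq_bigr => i _; rewrite mul1r.
Qed.

(** When its coefficients are constant, [p(Q)] can be multiplied on the left by
    any operator without moving the coefficients of [p] away from the left. *)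
Lemma annihilates_companion (p : {poly R}) : der p = 0 ->
  eqmod (map_poly (@opC R) p).[Q] 0 -> horner_mx M p = 0.
Proof.
move=> dp [W]; rewrite horner_poly addr0 => eW.
apply/row_matrixP=> i; rewrite row0 rowE.
apply: (@eqmod_rowop_inj
   (\sum_(j < size p) opC p`_j * (rowop (delta_mx 0 i) * Q ^+ j))).
  exact: rowop_horner.
exists (rowop (delta_mx 0 i) * W); rewrite raddf0 addr0 -mulrA -eW mulr_sumr.
apply: eq_bigr => j _; rewrite !mulrA opC_central //.
by rewrite -coef_der dp coef0.
Qed.
End Companion.

(** * The differential resultant as a characteristic polynomial *)

Section Resultant.
Variable R : diffRingType.

(** Each row of [B] is reduced modulo the rows of [A]. The matrix becomes block
    triangular, and the block of [A] is triangular with the leading coefficient of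
    [A] on the diagonal. *)
Lemma dres_reduced n m (A B : diffop R) (X : 'I_n -> 'rV_m) (G : 'M_n) :
  dorder A = n -> dorder B = m ->
  (forall i, opX R ^+ rev_ord i * B = rowop (X i) * A + rowop (row i G)) ->
  dres A B = (dcoefs A)`_n ^+ m * \det G.
Proof.
move=> ordA ordB; rewrite /dres; move: X G; rewrite ordA ordB => X G eB.
have szA : (size (dcoefs A) <= n.+1)%N by rewrite -ordA leqSpred.
set top := \matrix_(i < m, j < m + n) _; set bot := \matrix_(i < n, j < m + n) _.
pose Y := \matrix_i X i.
have -> : bot = Y *m top + row_mx 0 G.
  apply/matrixP=> i j; rewrite !mxE eB dcoefsD coefD; congr (_ + _).
    rewrite mulr_suml dcoefs_sum coef_sum; apply: eq_bigr => k _.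
    by rewrite -mulrA dcoefs_opCM coefZ !mxE.
  case: splitP => k jk; rewrite ?mxE.
    rewrite nth_default // (leq_trans (size_rowop _)) //= jk -addnBAC //.
    by rewrite leq_addl.
  have -> : rev_ord j = rev_ord k :> nat by rewrite /= jk -addnS subnDl.
  by rewrite coef_rowop mxE.
have -> : col_mx top (Y *m top + row_mx 0 G) =
    block_mx 1%:M 0 Y 1%:M *m block_mx (lsubmx top) (rsubmx top) 0 G.
  rewrite mulmx_block !mul1mx !mul0mx !addr0 block_mxEv hsubmxK; congr col_mx.
  by rewrite -{1}[top]hsubmxK mul_mx_row add_row_mx addr0.
rewrite det_mulmx det_lblock !det1 !mul1r det_ublock; congr (_ * _).
rewrite -det_tr det_trig; last first.
  apply/is_trig_mxP => i j ij; rewrite !mxE dcoefs_opXnM nth_default //.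
  apply: leq_trans (size_iter_dshift _ szA) _ => /=.
  by rewrite addnS -addSn subnSK // -addnBAC // leq_add2r leq_sub2l.
rewrite (eq_bigr (fun=> (dcoefs A)`_n)) ?prodr_const ?card_ord // => i _.
by rewrite !mxE dcoefs_opXnM /= -addnBAC // coef_iter_dshift.
Qed.
End Resultant.

Section LiftResultant.
Variable R : diffRingType.

Lemma oplift_rowop k (v : 'rV[R]_k) : oplift (rowop v) = rowop (map_mx polyC v).
Proof.
rewrite rmorph_sum; apply: eq_bigr => i _.
by rewrite rmorphM rmorphXn /= oplift_opC oplift_opX mxE.
Qed.

Lemma dorder_oplift (X : diffop R) : dorder (oplift X) = dorder X.
Proof. by rewrite /dorder size_map_inj_poly //; apply: polyC_inj. Qed.

Lemma dorder_subC (X : diffop R) a : (0 < dorder X)%N ->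
  dorder (X - opC a) = dorder X.
Proof.
rewrite /dorder dcoefsD dcoefsN => X_gt0; rewrite size_polyDl // size_polyN.
by apply: leq_ltn_trans (size_polyC_leq1 _) _; rewrite -ltn_predRL.
Qed.
End LiftResultant.

(** The remainder of [D ^ i * (Q - 'X)] is that of [D ^ i * Q] minus ['X D ^ i]. *)
Lemma dres_char_poly (R : diffRingType) n m (A Q : diffop R)
    (X : 'I_n -> 'rV_m) (M : 'M_n) :
  dorder A = n -> dorder Q = m -> (0 < m)%N ->
  (forall i, opX R ^+ rev_ord i * Q = rowop (X i) * A + rowop (row i M)) ->
  dres (oplift A) (oplift Q - opC 'X) =
    ((dcoefs A)`_n ^+ m * (-1) ^+ n)%:P * char_poly M.
Proof.
move=> ordA ordQ m_gt0 eQ.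
rewrite (@dres_reduced _ n m _ _ (fun i => map_mx polyC (X i))
  (- char_poly_mx M)).
- by rewrite -scaleN1r detZ mulrA coef_map polyCM !polyC_exp polyCN polyC1.
- by rewrite dorder_oplift.
- by rewrite dorder_subC dorder_oplift ordQ.
move=> i; rewrite mulrBr -opC_central ?derX // -oplift_rowop -oplift_opX.
rewrite -rmorphXn -rmorphM /= eQ rmorphD rmorphM /= -addrA; congr (_ + _).
have -> : row i (- char_poly_mx M) = map_mx polyC (row i M) - 'X *: delta_mx 0 i.
  apply/rowP=> k; rewrite !mxE opprB eqxx /= eq_sym -mulr_natr.
  by case: eqP; rewrite ?mulr1 ?mulr0.
rewrite raddfB /= -oplift_rowop -opC_rowop rowop_delta /=; congr (_ - _ * _).
by rewrite rmorphXn /= oplift_opX.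
Qed.

(** * Gauss's lemma and powers of a prime *)

Section GaussLemma.
Variable K : fieldType.
Hypothesis closedK : GRing.closed_field_axiom K.
Implicit Types (r : {poly K}) (a b x p : {poly {poly K}}).

Lemma closed_root r : (1 < size r)%N -> exists c, root r c.
Proof.
case def_n: (size r) => [|[|n]] // _.
have lr0 : lead_coef r != 0 by rewrite lead_coef_eq0 -size_poly_eq0 def_n.
have [c ec] := @closedK n.+1 (fun i => - r`_i / lead_coef r) isT.
exists c; apply/eqP; rewrite horner_coef def_n big_ord_recr /= ec mulr_sumr.
rewrite -big_split big1 //= => i _.
have -> : r`_n.+1 = lead_coef r by rewrite lead_coefE def_n.
by rewrite !mulNr mulrN mulrA mulrCA mulfV // mulr1 subrr.
Qed.

Lemma vanish_at c a : map_poly (horner_eval c) a = 0 ->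
  exists a1, a = ('X - c%:P) *: a1.
Proof.
move=> a0; exists (map_poly (fun r => r %/ ('X - c%:P)) a).
apply/polyP=> i; rewrite coefZ coef_map_id0 ?div0p // mulrC divpK //.
by rewrite dvdp_XsubCl rootE -[_.[c]]/(horner_eval c _) -coef_map a0 coef0.
Qed.

(** Gauss's lemma. The primes of [{poly K}] are the ['X - c], and reduction modulo
    ['X - c] is evaluation at [c], with values in a domain. *)
Lemma gauss_split r x a b : r != 0 -> r *: x = a * b ->
  exists a' b' r1 r2, [/\ x = a' * b', a = r1 *: a' & b = r2 *: b'].
Proof.
elim: {r}(size r) {-2}r (leqnn (size r)) x a b => [|n IH] r le_rn x a b r0 e.
  by rewrite -size_poly_leq0 le_rn in r0.
have [r_const | r_gt1] := leqP (size r) 1.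
  move: r0 e; rewrite (size1_polyC r_const) polyC_eq0; set c := r`_0 => c0 e.
  exists a, ((c^-1)%:P *: b), 1, c%:P; split; last 2 first.
  - by rewrite scale1r.
  - by rewrite scalerA -polyCM mulfV // scale1r.
  by rewrite -scalerAr -e scalerA -polyCM mulVf // scale1r.
have [c /factor_theorem[r' def_r]] := closed_root r_gt1.
have r'0 : r' != 0 by apply: contra r0 => /eqP r'0; rewrite def_r r'0 mul0r.
have Xc0 : ('X - c%:P : {poly K}) != 0 by rewrite polyXsubC_eq0.
have szr' : (size r' <= n)%N.
  by rewrite -ltnS (leq_trans _ le_rn) // def_r size_Mmonic ?monicXsubC //
    size_XsubC addn2.
have cancel (y z : {poly {poly K}}) : ('X - c%:P : {poly K}) *: y = ('X - c%:P) *: z -> y = z.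
  by rewrite -!mul_polyC; apply: mulfI; rewrite polyC_eq0.
have : map_poly (horner_eval c) a * map_poly (horner_eval c) b = 0.
  rewrite -rmorphM -e -mul_polyC rmorphM /= map_polyC /= def_r /horner_eval.
  by rewrite hornerM hornerXsubC subrr mulr0 mul0r.
move/eqP; rewrite mulf_eq0 => /orP[/eqP/vanish_at[a1 ea]|/eqP/vanish_at[b1 eb]].
  have [|a' [b' [r1 [r2 [-> ea1 ->]]]]] := IH r' szr' x a1 b r'0.
    by apply: cancel; rewrite scalerA mulrC -def_r e ea scalerAl.
  by exists a', b', (('X - c%:P) * r1), r2; rewrite ea ea1 scalerA.
have [|a' [b' [r1 [r2 [-> -> eb1]]]]] := IH r' szr' x a b1 r'0.
  by apply: cancel; rewrite scalerA mulrC -def_r e eb scalerAr.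
by exists a', b', r1, (('X - c%:P) * r2); rewrite eb eb1 scalerA.
Qed.
End GaussLemma.

Section PrimePowers.
Variable R : idomainType.

Definition prime_elt (p : R) := [/\ p != 0, p \isn't a GRing.unit
  & forall a b q, a * b = q * p -> (exists q', a = q' * p) \/ (exists q', b = q' * p)].

Lemma dvd_prime_power (p : R) n x y : prime_elt p -> x * y = p ^+ n ->
  exists u e, u \is a GRing.unit /\ x = u * p ^+ e.
Proof.
case=> p0 _ p_prime; elim: n x y => [|n IH] x y exy.
  exists x, 0%N; rewrite mulr1; split=> //.
  by apply/unitrPr; exists y.
have [|[x' ex]|[y' ey]] := p_prime x y (p ^+ n); first by rewrite -exprSr.
  have [|u [e [uu ex']]] := IH x' y.
    by apply: (mulfI p0); rewrite mulrA [p * x']mulrC -ex exy exprS.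
  by exists u, e.+1; rewrite ex ex' -mulrA -exprSr.
apply: (IH x y'); apply: (mulIf p0).
by rewrite -mulrA -ey exy exprSr.
Qed.

Lemma square_free_part_prime_power (p w : R) e : irreducible_elt p ->
  w \is a GRing.unit -> (0 < e)%N -> square_free_part (w * p ^+ e) p.
Proof.
move=> p_irr uw e_gt0; exists 1%N, (fun=> p), (fun=> e), w, 1.
by split; rewrite ?big_ord1 ?mul1r ?unitr1 // => i j; rewrite !ord1 eqxx.
Qed.

(** The irreducible factors of a power of [p] are all associated with [p], so that
    pairwise non-associated ones number at most one. *)
Lemma square_free_part_uniq (p w f : R) e : prime_elt p ->
  w \is a GRing.unit -> (0 < e)%N -> square_free_part (w * p ^+ e) f ->
  associated f p.
Proof.
move=> p_prime uw e_gt0 [k [q [d [u [v [[uu uv] q_irr q_assoc eh ->]]]]]].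
have p_nunit : p \isn't a GRing.unit by case: p_prime.
have qp i : associated (q i) p.
  have [[q0 q_nunit q_split] d_gt0] := q_irr i.
  have [|u' [j [uu' eq]]] :=
      @dvd_prime_power p e (q i) (w^-1 * u * (q i ^+ (d i).-1 *
        \prod_(i' | i' != i) q i' ^+ d i')) p_prime.
    rewrite mulrCA [q i * _]mulrA -exprS prednK // -mulrA.
    by move: eh; rewrite (bigD1 i) //= => <-; rewrite mulKr.
  case: j eq => [|j] eq; first by rewrite eq mulr1 uu' in q_nunit.
  have [|pu|up] := q_split p (u' * p ^+ j); first by rewrite eq mulrCA exprS.
    by rewrite pu in p_nunit.
  by exists (u' * p ^+ j); rewrite // eq exprSr mulrA.
have assoc_trans i j : associated (q i) (q j).
  have [a ua ->] := qp i; have [b ub ->] := qp j.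
  by exists (a / b); rewrite ?unitrMl ?unitrV // mulrA divrK.
case: k q d q_irr q_assoc eh qp assoc_trans => [|[|k]] q d _ q_assoc eh qp qq.
- move: eh; rewrite big_ord0 mulr1 => eh.
  move: uu; by rewrite -eh unitrMr // unitrX_pos // (negPf p_nunit).
- rewrite big_ord1; have [a ua ->] := qp ord0.
  by exists (v * a); rewrite ?unitrMl // mulrA.
by case: (q_assoc ord0 ord_max) => //; apply: qq.
Qed.
End PrimePowers.

(** * Principality of a prime kernel *)

Section PrincipalKernel.
(* A prime ideal is presented as the kernel of a morphism to a domain. *)
Variables (K : fieldType) (T : nzRingType).
Hypothesis closedK : GRing.closed_field_axiom K.
Variable phi : {rmorphism {poly {poly K}} -> T}.
Hypothesis domT : forall x y : T, x * y = 0 -> x = 0 \/ y = 0.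
Variable chi : {poly {poly K}}.
Hypotheses (chi_monic : chi \is monic) (phi_chi : phi chi = 0).
Hypothesis ker_chi : forall g, phi g = 0 -> exists N k, g ^+ N = k * chi.
Implicit Types (p q g a b : {poly {poly K}}) (r : {poly K}).

Lemma ker_prime a b : phi (a * b) = 0 -> phi a = 0 \/ phi b = 0.
Proof. by rewrite rmorphM; apply: domT. Qed.

Lemma ker_nunit a : phi a = 0 -> a \isn't a GRing.unit.
Proof.
move=> a0; apply/negP=> /divrr/(congr1 phi)/eqP.
by rewrite rmorphM a0 mul0r rmorph1 eq_sym oner_eq0.
Qed.

Lemma ker_monic_gt1 p : p \is monic -> phi p = 0 -> (1 < size p)%N.
Proof.
move=> mp p0; rewrite ltnNge; apply/negP=> le_p1.
have p1 : p = 1.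
  rewrite (size1_polyC le_p1) -[p`_0]lead_coefC -(size1_polyC le_p1).
  by rewrite (monicP mp).
by have := ker_nunit p0; rewrite p1 unitr1.
Qed.

(** The kernel meets [{poly K}] trivially, since a power of any of its elements is
    a multiple of the nonconstant monic [chi]. *)
Lemma ker_const r g : r != 0 -> phi (r *: g) = 0 -> phi g = 0.
Proof.
move=> r0; rewrite -mul_polyC => /ker_prime[] // /ker_chi[N [k e]].
have := ker_monic_gt1 chi_monic phi_chi; rewrite ltnNge => /negP[].
apply: leq_trans (size_polyC_leq1 (r ^+ N)); rewrite polyC_exp e.
have k0 : k != 0.
  apply: contraTneq r0 => k0; move: e; rewrite k0 mul0r => /eqP.
  by rewrite expf_eq0 polyC_eq0 => /andP[_ ->].
apply: dvdp_leq; first exact: mulf_neq0 k0 (monic_neq0 chi_monic).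
by apply: dvdp_mull (dvdpp _).
Qed.

Lemma minimal_ker : exists p, [/\ p \is monic, phi p = 0
  & forall q, q \is monic -> phi q = 0 -> (size p <= size q)%N].
Proof.
have [n] := ubnP (size chi).
elim: n chi chi_monic phi_chi => // n IH p mp p0 le_pn.
(* The alternative ranges over infinitely many polynomials and is not decidable. *)
have [[q [mq q0 lt_qp]]|no_q] :=
    classic (exists q, [/\ q \is monic, phi q = 0 & (size q < size p)%N]).
  by apply: (IH q); rewrite // (leq_trans lt_qp).
by exists p; split=> // q mq q0; rewrite leqNgt; apply/negP=> lt; case: no_q; exists q.
Qed.

(** With [p] of least degree among the monic elements of the kernel and [g] in the
    kernel, [gcdp p g] lies in the kernel up to a factor in [{poly K}]; by Gauss's
    lemma so does a monic divisor of [p] of the same degree as [gcdp p g]. By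
    minimality this gcd has the degree of [p], and [p] divides [g]. *)
Lemma minimal_ker_dvd p g : p \is monic -> phi p = 0 ->
  (forall q, q \is monic -> phi q = 0 -> (size p <= size q)%N) ->
  phi g = 0 -> exists q, g = q * p.
Proof.
move=> mp p0 min_p g0; set d := gcdp p g.
have d0 : phi d = 0.
  have [u] := Bezoutp p g; case/eqpP=> [[c1 c2]] /= /andP[_ c20] e.
  apply: (ker_const c20); rewrite -e -mul_polyC !rmorphM rmorphD !rmorphM.
  by rewrite p0 g0 !mulr0 addr0 mulr0.
have /Pdiv.WeakIdomain.dvdpP[[r e] /= r0 er] : d %| p by apply: dvdp_gcdl.
have [e' [d' [r1 [r2 [ep ee ed]]]]] := gauss_split closedK r0 er.
have r20 : r2 != 0.
  apply: contraTneq (monic_neq0 mp) => r20.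
  have : d = 0 by rewrite ed r20 scale0r.
  by move/eqP; rewrite gcdp_eq0 => /andP[/eqP->]; rewrite eqxx.
have d'0 : phi d' = 0 by apply: (ker_const r20); rewrite -ed.
have lead_unit : lead_coef e' * lead_coef d' = 1.
  by rewrite -lead_coefM -ep (eqP mp).
have md : lead_coef e' *: d' \is monic by rewrite monicE lead_coefZ lead_unit.
have e'0 : lead_coef e' != 0.
  by apply: contraTneq (oner_neq0 {poly K}) => e0; rewrite -lead_unit e0 mul0r eqxx.
have szd : size d = size (lead_coef e' *: d') by rewrite ed !size_scale.
have dp : d %= p.
  rewrite -dvdp_size_eqp ?dvdp_gcdl // eqn_leq dvdp_leq ?dvdp_gcdl ?monic_neq0 //=.
  by rewrite szd min_p // -mul_polyC rmorphM d'0 mulr0.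
have : p %| g by rewrite -(eqp_dvdl _ dp) dvdp_gcdr.
by case/(Pdiv.IdomainMonic.dvdpP mp) => q ->; exists q.
Qed.

(** Since [d | chi | d ^ N] for the generator [d], the polynomial [chi] is a power
    of [d]. *)
Theorem ker_principal : exists p, [/\ p \is monic, irreducible_elt p, prime_elt p,
  forall g, phi g = 0 <-> exists q, g = q * p
  & exists u e, [/\ u \is a GRing.unit, (0 < e)%N & chi = u * p ^+ e]].
Proof.
have [p [mp p0 min_p]] := minimal_ker.
have kerP g : phi g = 0 <-> exists q, g = q * p.
  split; first exact: minimal_ker_dvd.
  by case=> q ->; rewrite rmorphM p0 mulr0.
have pn0 := monic_neq0 mp.
have p_prime : prime_elt p.
  split=> [//||a b q e]; first exact: ker_nunit.
  have [|/kerP ?|/kerP ?] := @ker_prime a b; [|by left|by right].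
  by rewrite e rmorphM p0 mulr0.
exists p; split=> //.
  split=> [//||a b eab]; first exact: ker_nunit.
  have [|/kerP[q ea]|/kerP[q eb]] := @ker_prime a b; first by rewrite -eab.
    right; apply/unitrPr; exists q; apply: (mulfI pn0).
    by rewrite mulr1 [b * q]mulrC mulrA [p * q]mulrC -ea -eab.
  left; apply/unitrPr; exists q; apply: (mulfI pn0).
  by rewrite mulr1 mulrC -mulrA -eb -eab.
have [N [k e]] := ker_chi p0.
have [|u [j [uu echi]]] := @dvd_prime_power _ p N chi k p_prime.
  by rewrite mulrC -e.
exists u, j; split=> //; case: j echi => // echi.
by have := ker_nunit phi_chi; rewrite echi mulr1 uu.
Qed.

(** In [r p = e gcd(p, p')] with [r] constant in the main variable, one of the two
    factors lies in the prime kernel, hence is a multiple of [p]. The gcd divides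
    [p'] and is too small for that, so [e] is such a multiple and the gcd is
    constant. *)
Lemma ker_generator_separable p : p \is monic ->
  (forall g, phi g = 0 <-> exists q, g = q * p) ->
  (forall n, n.+1%:R != 0 :> K) -> coprimep p p^`().
Proof.
move=> mp kerP charK.
have p0 : phi p = 0 by apply/kerP; exists 1; rewrite mul1r.
have p_gt1 := ker_monic_gt1 mp p0.
have p'0 : p^`() != 0.
  apply/eqP=> /(congr1 (fun q => q`_(size p).-2)); rewrite coef_deriv coef0.
  have -> : (size p).-2.+1 = (size p).-1 by case: (size p) p_gt1 => [|[]].
  rewrite -lead_coefE (monicP mp) => /(congr1 (fun q : {poly K} => q`_0)) /eqP.
  case: (size p) p_gt1 => [|[|n]] // _.
  by rewrite coef0 coefMn coef1 (negPf (charK n)).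
have /Pdiv.WeakIdomain.dvdpP[[r e] /= r0 er] : gcdp p p^`() %| p by apply: dvdp_gcdl.
have : phi (e * gcdp p p^`()) = 0 by rewrite -er -mul_polyC rmorphM p0 mulr0.
case/ker_prime=> [/kerP[q eq]|/kerP[q ed]].
  have erq : r%:P = q * gcdp p p^`().
    by apply: (mulfI (monic_neq0 mp)); rewrite mulrCA mulrA -eq -er mulrC mul_polyC.
  have d0 : gcdp p p^`() != 0 by rewrite gcdp_eq0 negb_and monic_neq0.
  rewrite /coprimep eqn_leq size_poly_gt0 d0 andbT.
  apply: leq_trans (size_polyC_leq1 r); apply: dvdp_leq; rewrite ?polyC_eq0 //.
  by rewrite erq dvdp_mull.
have : (size p <= size p^`())%N.
  apply: dvdp_leq p'0 _; apply: dvdp_trans (dvdp_gcdr p _).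
  by rewrite ed dvdp_mull.
by rewrite leqNgt lt_size_deriv ?monic_neq0.
Qed.
End PrincipalKernel.

Section Separable.
Variable R : idomainType.
Implicit Types p g : {poly R}.

(** Let [d = gcdp p g] and [p = e d] up to a constant. As [p] has no multiple
    factor, [e] is coprime to [d], hence to [g]; being a divisor of [g ^+ k], it is
    constant. *)
Lemma dvdp_exp_separable p g k : p != 0 -> coprimep p p^`() -> p %| g ^+ k -> p %| g.
Proof.
move=> p0 sep pgk; set d := gcdp p g.
have /Pdiv.WeakIdomain.dvdpP[[r e] /= r0 er] : d %| p by apply: dvdp_gcdl.
have ep : e %| p by rewrite -(dvdpZr _ _ r0) er dvdp_mulr.
have cop_ed : coprimep e d.
  apply/coprimepP => c ce cd; move/coprimepP: sep; apply.
    exact: dvdp_trans ep.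
  by rewrite -(dvdpZr _ _ r0) -derivZ er derivM; apply: dvdp_add; [apply: dvdp_mull | apply: dvdp_mulr].
have cop_eg : coprimep e g.
  apply/coprimepP => c ce cg; move/coprimepP: cop_ed; apply=> //.
  by rewrite dvdp_gcd cg (dvdp_trans ce ep).
have e1 : e %| 1.
  by rewrite -(Gauss_dvdpr 1 (coprimep_expr k cop_eg)) mulr1 (dvdp_trans ep).
have : p %| d.
  by rewrite -(dvdpZl _ _ r0) er -{2}[d]mul1r dvdp_mul.
by move/dvdp_trans; apply; apply: dvdp_gcdr.
Qed.

Lemma coprimep_deriv_map (S : idomainType) (f : {rmorphism R -> S}) p :
  injective f -> coprimep p p^`() -> coprimep (map_poly f p) (map_poly f p)^`().
Proof.
move=> f_inj /Bezout_coprimepP[[u v] /=].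
case/eqpP=> [[c1 c2]] /= /andP[c10 c20] e.
apply/Bezout_coprimepP; exists (map_poly f u, map_poly f v) => /=.
apply/eqpP; exists (f c1, f c2) => /=.
  by rewrite -(rmorph0 f) !(inj_eq f_inj) c10.
rewrite deriv_map -!rmorphM -rmorphD -!mul_polyC -!map_polyC -rmorphM /=.
by rewrite mul_polyC e -mul_polyC rmorphM rmorph1.
Qed.
End Separable.

(** * Operators with coefficients in a field, and centralizers *)

Section FieldOperators.
Variable F : diffFieldType.
Notation C := (constants F).
Implicit Types (X Y P : diffop F) (c : C).

Lemma size_dcoefs_eq0 X : (size (dcoefs X) <= 0)%N -> X = 0.
Proof. by rewrite size_poly_leq0 => /eqP X0; apply: dcoefs_inj. Qed.

Lemma lead_dcoefs X n : size (dcoefs X) = n.+1 -> (dcoefs X)`_n != 0.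
Proof.
move=> szX; have := lead_coef_eq0 (dcoefs X).
by rewrite lead_coefE szX /= => ->; rewrite -size_poly_eq0 szX.
Qed.

Lemma diffop_domain X Y : X * Y = 0 -> X = 0 \/ Y = 0.
Proof.
case eX: (size (dcoefs X)) => [|n]; first by left; apply: size_dcoefs_eq0; rewrite eX.
case eY: (size (dcoefs Y)) => [|m]; first by right; apply: size_dcoefs_eq0; rewrite eY.
move/(congr1 (fun Z => (dcoefs Z)`_(n + m)))/eqP.
rewrite coef_pmul_top ?eX ?eY // coef0 mulf_eq0.
by rewrite (negPf (lead_dcoefs eX)) (negPf (lead_dcoefs eY)).
Qed.

Lemma der_cval c : der (cval c) = 0.
Proof. by apply/eqP; case: c. Qed.

Lemma opC_cval_comm c X : opC (cval c) * X = X * opC (cval c).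
Proof. exact/opC_central/der_cval. Qed.

Lemma constP (a : F) : der a = 0 -> exists c, cval c = a.
Proof. by move=> /eqP da; exists (Const (da : a \in @is_const F)). Qed.

Lemma cval_inj : injective (@cval F).
Proof. exact: val_inj. Qed.

Lemma cval_is_additive : zmod_morphism (@cval F). Proof. by []. Qed.
HB.instance Definition _ :=
  GRing.isZmodMorphism.Build C F (@cval F) cval_is_additive.
Lemma cval_is_multiplicative : monoid_morphism (@cval F). Proof. by []. Qed.
HB.instance Definition _ :=
  GRing.isMonoidMorphism.Build C F (@cval F) cval_is_multiplicative.

Hypothesis charC : [pchar C] =i pred0.

Lemma natrF_neq0 n : n.+1%:R != 0 :> F.
Proof.
have /pcharf0P/(_ n.+1) := charC.
by rewrite -(inj_eq cval_inj) rmorph_nat => ->.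
Qed.

Section Centralizer.
Variables (P : diffop F) (n : nat).
Hypothesis sizeP : size (dcoefs P) = n.+2.

(** The coefficient of [D ^ (n + m)] in [P * X - X * P]. *)
Lemma centralizer_lead X m : (size (dcoefs X) <= m.+1)%N -> P * X = X * P ->
  (dcoefs P)`_n.+1 * der (dcoefs X)`_m *+ n.+1 =
  (dcoefs X)`_m * der (dcoefs P)`_n.+1 *+ m.
Proof.
move=> szX /(congr1 (fun Z => (dcoefs Z)`_(n + m))).
rewrite coef_pmul_sub ?sizeP //; set p := dcoefs P; set x := dcoefs X.
have -> : (pmul x p)`_(n + m) =
    x`_m * p`_n + ((x * 'X)`_m * p`_n.+1 + x`_m * der p`_n.+1 *+ m).
  case: m szX => [|m] szX.
    rewrite (pmul_wide _ szX) big_ord1 coefZ addn0 coefMX mul0r mulr0n.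
    by rewrite !addr0.
  rewrite -addSnnS addnC coef_pmul_sub ?sizeP // !coefMX /= mulrDr mulrnAr.
  by rewrite addrAC addrA.
rewrite addrC [p`_n * _]mulrC mulrDr [p`_n.+1 * (x * 'X)`_m]mulrC mulrnAr.
by move=> /addrI/addrI.
Qed.

(** By [centralizer_lead], the leading coefficients solve the same homogeneous
    linear differential equation of order one. *)
Lemma centralizer_lead_ratio X Y m :
  (size (dcoefs X) <= m.+1)%N -> (size (dcoefs Y) <= m.+1)%N ->
  P * X = X * P -> P * Y = Y * P -> (dcoefs Y)`_m != 0 ->
  exists c, cval c * (dcoefs Y)`_m = (dcoefs X)`_m.
Proof.
move=> szX szY PX PY y0.
have ex := centralizer_lead szX PX; have ey := centralizer_lead szY PY.
move: ex ey y0; set x := (dcoefs X)`_m; set y := (dcoefs Y)`_m.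
set p := (dcoefs P)`_n.+1 => ex ey y0.
have p0 : p != 0 by apply: lead_dcoefs.
have xy : der x * y = x * der y.
  apply: (mulfI p0); apply: (mulfI (natrF_neq0 n)); rewrite !mulr_natl.
  rewrite [RHS](_ : _ = x * (p * der y *+ n.+1)); last by rewrite mulrCA mulrnAr.
  rewrite ey [LHS](_ : _ = p * der x *+ n.+1 * y); last by rewrite mulrA mulrnAl.
  by rewrite ex mulrnAl mulrnAr [y * _]mulrC mulrA.
have [c ec] : exists c, cval c = x / y.
  apply: constP; apply: (mulIf (mulf_neq0 y0 y0)); rewrite mul0r mulrA.
  have := derM (x / y) y; rewrite divfK // => dx.
  have -> : der (x / y) * y = der x - x / y * der y by rewrite dx addrK.
  by rewrite mulrBl xy mulrAC divfK // subrr.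
by exists c; rewrite ec divfK.
Qed.

(** Induction on a bound for the orders: an operator of top order is used to lower
    the order of the others by subtracting constant multiples of it, which stays
    in the centralizer of [P]. *)
Lemma centralizer_free (I : finType) (S : {set I}) (X : I -> diffop F) (a : I -> F) :
  (forall i, i \in S -> P * X i = X i * P) ->
  \sum_(i in S) opC (a i) * X i = 0 -> (exists2 i, i \in S & a i != 0) ->
  exists c : I -> C, \sum_(i in S) opC (cval (c i)) * X i = 0 /\
    exists2 i, i \in S & c i != 0.
Proof.
have [N szX] : exists N, forall i, i \in S -> (size (dcoefs (X i)) <= N)%N.
  by exists (\max_i size (dcoefs (X i))) => i _; apply: leq_bigmax.
elim: N S X szX => [|N IH] S X szX PX sum0 [i1 i1S ai1].
  exists (fun=> 1); split; last by exists i1; rewrite ?oner_eq0.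
  by rewrite big1 // => i iS; rewrite (size_dcoefs_eq0 (szX i iS)) mulr0.
have [[i0 /andP[i0S xi0]]|no_lead] :=
    altP (@existsP _ (fun i => (i \in S) && ((dcoefs (X i))`_N != 0))); last first.
  apply: (IH S X) => // [i iS|]; last by exists i1.
  apply/leq_sizeP=> j; rewrite leq_eqVlt => /orP[/eqP<-|lt_Nj].
    apply/eqP; apply: contraNT no_lead => xi; apply/existsP; exists i.
    by rewrite iS.
  by rewrite nth_default // (leq_trans (szX i iS)).
have /fin_all_exists[c cP] : forall i, exists ci : C, i \in S ->
    cval ci * (dcoefs (X i0))`_N = (dcoefs (X i))`_N.
  move=> i; case iS: (i \in S); last by exists 0.
  have [ci eci] := centralizer_lead_ratio (szX i iS) (szX i0 i0S) (PX i iS)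
    (PX i0 i0S) xi0.
  by exists ci.
pose S' := S :\ i0; pose X' i := X i - opC (cval (c i)) * X i0.
have sumE (d : I -> F) : \sum_(i in S) opC (d i) * X i =
    \sum_(i in S') opC (d i) * X' i +
    opC (d i0 + \sum_(i in S') d i * cval (c i)) * X i0.
  rewrite rmorphD rmorph_sum mulrDl mulr_suml /= addrCA -big_split /=.
  rewrite (big_setD1 i0) //=; congr (_ + _); apply: eq_bigr => i _.
  by rewrite mulrBr rmorphM /= mulrA subrK.
have coefX' i : i \in S' -> (dcoefs (X' i))`_N = 0.
  rewrite !inE => /andP[_ iS].
  by rewrite dcoefsD dcoefsN coefB dcoefs_opCM coefZ cP // subrr.
have last0 : a i0 + \sum_(i in S') a i * cval (c i) = 0.
  have /(congr1 (fun Z => (dcoefs Z)`_N)) := sumE a.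
  rewrite sum0 coef0 dcoefsD coefD dcoefs_sum coef_sum dcoefs_opCM coefZ.
  rewrite big1 => [|i iS']; last by rewrite dcoefs_opCM coefZ coefX' ?mulr0.
  by rewrite add0r => /esym/eqP; rewrite mulf_eq0 (negPf xi0) orbF => /eqP.
have [] := IH S' X'.
- move=> i iS'; have iS : i \in S by move: iS'; rewrite inE => /andP[].
  apply/leq_sizeP=> j; rewrite leq_eqVlt => /orP[/eqP<-|lt_Nj]; first exact: coefX'.
  rewrite dcoefsD dcoefsN coefB dcoefs_opCM coefZ.
  by rewrite !nth_default ?mulr0 ?subrr // (leq_trans (szX _ _)).
- move=> i; rewrite inE => /andP[_ iS].
  by rewrite mulrBr mulrBl PX // -mulrA -(PX i0) // !mulrA opC_cval_comm.
- by move: sum0; rewrite sumE last0 raddf0 mul0r addr0.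
- apply/exists_inP; apply: contraTT ai1; rewrite negb_exists_in => /forall_inP a0.
  have {}a0 i : i \in S' -> a i = 0 by move=> /a0; rewrite negbK => /eqP.
  rewrite negbK; have [-> | i10] := eqVneq i1 i0.
    by move: last0; rewrite big1 ?addr0 => [->|i /a0->]; rewrite ?mul0r.
  by rewrite a0 // !inE i10.
move=> d [sumd [i2 i2S' di2]].
pose d0 := - \sum_(i in S') d i * c i.
exists (fun i => if i == i0 then d0 else d i); split; last first.
  move: i2S'; rewrite !inE => /andP[/negPf i20 i2S].
  by exists i2; rewrite ?i20.
rewrite sumE eqxx (eq_bigr (fun i => opC (cval (d i)) * X' i)); last first.
  by move=> i; rewrite !inE => /andP[/negPf->].
rewrite sumd add0r [X in _ + X](eq_bigr (fun i => cval (d i * c i))); last first.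
  by move=> i; rewrite !inE => /andP[/negPf-> _]; rewrite rmorphM.
by rewrite -rmorph_sum -rmorphD /= addNr !rmorph0 mul0r.
Qed.
End Centralizer.
End FieldOperators.

(** * Evaluation at a pair of commuting operators *)

Section BivariateConstants.
Variable F : diffFieldType.
Notation C := (constants F).
Implicit Types (g a d : bipoly C).

HB.instance Definition _ := GRing.RMorphism.copy (@bivar_val F)
  (map_poly (map_poly (@cval F))).

Lemma bivar_val_inj : injective (@bivar_val F).
Proof.
apply: map_inj_poly; last exact: rmorph0.
by apply: map_inj_poly; [apply: cval_inj | apply: rmorph0].
Qed.

Lemma coef_bivar_val g i j : (bivar_val g)`_i`_j = cval g`_i`_j.
Proof. by rewrite !coef_map. Qed.

Lemma size_bivar_val g : size (bivar_val g) = size g.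
Proof.
apply: size_map_inj_poly; last exact: rmorph0.
by apply: map_inj_poly; [apply: cval_inj | apply: rmorph0].
Qed.

Lemma bivar_val_monic g : g \is monic -> bivar_val g \is monic.
Proof. exact: monic_map. Qed.

Lemma der_bivar_val g : der (bivar_val g) = 0.
Proof.
by apply/polyP=> i; apply/polyP=> j; rewrite !coef_der coef_bivar_val der_cval !coef0.
Qed.

Lemma constant_bipoly (u : bipoly F) : der u = 0 -> exists g, u = bivar_val g.
Proof.
move=> du; pose c : F -> C := insubd 0.
have cK i j : cval (c u`_i`_j) = u`_i`_j.
  by rewrite insubdK // -[_ \in _]/(der u`_i`_j == 0) -!coef_der du !coef0.
have c0 : c 0 = 0 by apply: val_inj; rewrite insubdK // -[_ \in _]/(der (0 : F) == 0) raddf0.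
exists (map_poly (map_poly c) u); apply/polyP=> i; apply/polyP=> j.
have mc0 : map_poly c 0 = 0 by apply/polyP=> k; rewrite coef_map_id0 // !coef0.
by rewrite coef_bivar_val coef_map_id0 // coef_map_id0 // cK.
Qed.

(** Division by a monic polynomial does not leave the constants. *)
Lemma bivar_val_dvd d a (k : bipoly F) : d \is monic ->
  bivar_val a = k * bivar_val d -> exists k0, a = k0 * d.
Proof.
move=> md e; have ea := Pdiv.RingMonic.rdivp_eq md a.
set q := Pdiv.Ring.rdivp a d in ea; set r := Pdiv.Ring.rmodp a d in ea.
have szr : (size r < size d)%N.
  by rewrite Pdiv.Ring.ltn_rmodpN0 // monic_neq0.
exists q; suff r0 : r = 0 by rewrite ea r0 addr0.
apply: bivar_val_inj; rewrite rmorph0; apply/eqP; apply: contraTT szr => r0.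
have er : bivar_val r = (k - bivar_val q) * bivar_val d.
  by rewrite mulrBl -e {1}ea rmorphD rmorphM /= addrC addKr.
have kq0 : k - bivar_val q != 0.
  by apply: contra r0 => /eqP kq; rewrite er kq mul0r.
rewrite -leqNgt -(size_bivar_val r) er size_Mmonic ?bivar_val_monic //.
rewrite size_bivar_val; move: kq0; rewrite -size_poly_gt0.
by case: (size _) => // s _; rewrite addSn leq_addl.
Qed.

(** The generator has derivative zero, so that its multiples are stable under the
    derivation. *)
Lemma gen_dideal_constant d u :
  gen_dideal (bivar_val d) u <-> exists q, u = q * bivar_val d.
Proof.
split=> [gen|[q ->] I [_ _ IM _] Id]; last exact: IM.
apply: (gen (fun v => exists q, v = q * bivar_val d)); last first.
  by exists 1; rewrite mul1r.
split=> [|_ _ [q ->] [q' ->]|a0 _ [q ->]|_ [q ->]].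
- by exists 0; rewrite mul0r.
- by exists (q + q'); rewrite mulrDl.
- by exists (a0 * q); rewrite mulrA.
by exists (der q); rewrite derM der_bivar_val mulr0 addr0.
Qed.
End BivariateConstants.

Section CommutingOperators.
Variables (F : diffFieldType) (P Q : diffop F).
Hypothesis PQ : P * Q = Q * P.
Notation C := (constants F).
Implicit Types (g : bipoly C) (u : bipoly F).

Let opCc : C -> diffop F := @opC F \o @cval F.
Let opCc_comm_P : commr_rmorph opCc P.
Proof. by move=> c; apply: esym (opC_cval_comm c P). Qed.
Let evalP := horner_morph opCc_comm_P.
Let evalP_comm_Q : commr_rmorph evalP Q.
Proof.
move=> p; apply: commr_horner; first exact/esym.
by move=> i; rewrite coef_map; apply: opC_cval_comm.
Qed.

Lemma op_eval_is_additive : zmod_morphism (op_eval P Q).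
Proof. exact: (raddfB (horner_morph evalP_comm_Q)). Qed.
HB.instance Definition _ := GRing.isZmodMorphism.Build
  (bipoly C) (diffop F) (op_eval P Q) op_eval_is_additive.

Lemma op_eval_is_multiplicative : monoid_morphism (op_eval P Q).
Proof.
split; first exact: (rmorph1 (horner_morph evalP_comm_Q)).
exact: (rmorphM (horner_morph evalP_comm_Q)).
Qed.
HB.instance Definition _ := GRing.isMonoidMorphism.Build
  (bipoly C) (diffop F) (op_eval P Q) op_eval_is_multiplicative.

Definition eval_mu u : diffop {poly F} := (map_poly (@opC _) u).[oplift Q].
Definition eval_PQ u : diffop F := opev P (eval_mu u).
Let AP : diffop {poly F} := oplift P - opC 'X.

Lemma AP_comm_Q : AP * oplift Q = oplift Q * AP.
Proof.
rewrite mulrBl mulrBr -!rmorphM PQ; congr (_ - _).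
exact/opC_central/derX.
Qed.

Lemma op_liftE (X : diffop F) : op_lift X = oplift (oplift X).
Proof.
by apply: dcoefs_inj; rewrite /= -map_poly_comp.
Qed.

Lemma minus_lambdaE : minus_lambda P = oplift AP.
Proof. by rewrite /minus_lambda op_liftE raddfB /= oplift_opC. Qed.

Lemma minus_muE : minus_mu Q = oplift (oplift Q) - opC 'X.
Proof. by rewrite /minus_mu op_liftE. Qed.

Lemma eval_PQE u : eval_PQ u =
  \sum_(j < size u) (map_poly (@opC F) u`_j).[P] * Q ^+ j.
Proof.
rewrite /eval_PQ /eval_mu horner_poly raddf_sum; apply: eq_bigr => j _.
rewrite -rmorphXn /= opev_mul_oplift ?opev_opC //.
exact/commr_sym/commrX.
Qed.

Lemma eval_PQ_wide n m u : (size u <= n)%N -> (forall j, (size (u`_j)%R <= m)%N) ->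
  eval_PQ u = \sum_(ji : 'I_n * 'I_m) opC u`_(ji.1)`_(ji.2) * (P ^+ ji.2 * Q ^+ ji.1).
Proof.
move=> szu szuj.
rewrite eval_PQE (big_ord_widen _ (fun j => (map_poly (@opC F) u`_j).[P] * Q ^+ j) szu).
rewrite big_mkcond -(pair_bigA _ (fun (j : 'I_n) (i : 'I_m) => opC u`_j`_i * (P ^+ i * Q ^+ j))) /=.
apply: eq_bigr => j _; case: ltnP => [_|le_j]; last first.
  by rewrite big1 // => i _; rewrite (nth_default _ le_j) coef0 raddf0 mul0r.
rewrite (horner_coef_wide P (leq_trans (size_poly _ _) (szuj j))).
by rewrite mulr_suml; apply: eq_bigr => i _; rewrite coef_map mulrA.
Qed.

Lemma eval_PQ_bivar g : eval_PQ (bivar_val g) = op_eval P Q g.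
Proof.
rewrite eval_PQE size_bivar_val /op_eval horner_poly; apply: eq_bigr => j _.
by rewrite coef_map -map_poly_comp.
Qed.

Lemma eval_PQ_additive : zmod_morphism eval_PQ.
Proof. by move=> u v; rewrite /eval_PQ /eval_mu !raddfB /= hornerD hornerN raddfB. Qed.
HB.instance Definition _ := GRing.isZmodMorphism.Build
  (bipoly F) (diffop F) eval_PQ eval_PQ_additive.

Lemma eval_mu_mod u : eval_PQ u = 0 -> exists W, eval_mu u = W * AP.
Proof.
move=> u0; have [W eW] := opev_mod P (eval_mu u); exists W.
by rewrite -eW -[opev _ _]/(eval_PQ u) u0 raddf0 subr0.
Qed.

(** The elimination ideal is the kernel of the evaluation of [lambda] at [P] and
    of [mu] at [Q], both to the right of the coefficients: this evaluation kills
    the left ideal, and every operator is congruent to its value. *)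
Lemma elim_idealE u :
  elim_ideal (minus_lambda P) (minus_mu Q) u <-> eval_PQ u = 0.
Proof.
rewrite minus_lambdaE minus_muE; split=> [[U [V e]]|].
  rewrite /eval_PQ /eval_mu -opev_opC e raddfD /= opev_mul_root addr0.
  by rewrite opev_mul_oplift ?opev_mul_root // AP_comm_Q.
move/eval_mu_mod=> [W eW]; have [V eV] := opev_mod (oplift Q) (opC u).
exists (oplift W), V; rewrite -rmorphM -eW -eV opev_opC -/(eval_mu u).
by rewrite addrC subrK.
Qed.

Lemma eval_PQ_mull u v : eval_PQ v = 0 -> eval_PQ (u * v) = 0.
Proof.
move/elim_idealE=> [U [V e]]; apply/elim_idealE; exists (opC u * U), (opC u * V).
by rewrite rmorphM /= e mulrDr !mulrA.
Qed.
End CommutingOperators.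

(** * The spectral curve *)

Lemma poly_neq0_coef (R : nzRingType) (q : {poly R}) : q != 0 ->
  exists i : 'I_(size q), q`_i != 0.
Proof.
move=> q0; have lt : ((size q).-1 < size q)%N by rewrite ltn_predL size_poly_gt0.
by exists (Ordinal lt); rewrite -lead_coefE lead_coef_eq0.
Qed.

Section SpectralCurve.
Variables (F : diffFieldType) (P Q : diffop F).
Notation C := (constants F).
Hypothesis charC : [pchar C] =i pred0.
Hypothesis PQ : P * Q = Q * P.
Variables n m : nat.
Hypotheses (ordP : dorder P = n.+1) (ordQ : dorder Q = m.+1).
Let AP : diffop {poly F} := oplift P - opC 'X.
Implicit Types g : bipoly C.

Let sizeP : size (dcoefs P) = n.+2.
Proof. by move: ordP; rewrite /dorder; case: (size _) => //= k ->. Qed.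
Let sizeQ : size (dcoefs Q) = m.+2.
Proof. by move: ordQ; rewrite /dorder; case: (size _) => //= k ->. Qed.
Let p := (dcoefs P)`_n.+1.
Let p_neq0 : p != 0. Proof. exact: lead_dcoefs. Qed.

Lemma lead_AP : (dcoefs AP)`_n.+1 = p%:P.
Proof. by rewrite dcoefsD dcoefsN coefB coefC subr0 coef_map. Qed.

Lemma dorder_AP : dorder AP = n.+1.
Proof. by rewrite dorder_subC dorder_oplift ordP. Qed.

Lemma size_AP : (size (dcoefs AP) <= n.+2)%N.
Proof. by rewrite -dorder_AP leqSpred. Qed.

(** Here [chi] is the characteristic polynomial of the matrix of right
    multiplication by [Q] modulo [P - lambda]. Its membership in [BC] is
    Cayley-Hamilton; an element of [BC] annihilates that matrix, which makes [chi]
    divide one of its powers. *)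
Lemma resultant_char_poly : exists (a : F) (chi : bipoly C),
  [/\ a != 0 /\ chi \is monic,
      dres (minus_lambda P) (minus_mu Q) = a%:P%:P * bivar_val chi,
      op_eval P Q chi = 0
    & forall g, op_eval P Q g = 0 -> exists N k, g ^+ N = k * chi].
Proof.
have AQ : AP * oplift Q = oplift Q * AP by apply: AP_comm_Q.
have bA : (p^-1)%:P * (dcoefs AP)`_n.+1 = 1.
  by rewrite lead_AP -polyCM mulVf.
have szQ : size (dcoefs (oplift Q)) = m.+2.
  by rewrite size_map_inj_poly //; apply: polyC_inj.
have [|X [M' MP]] := @div_rows _ n.+1 AP (p^-1)%:P size_AP bA m.+1 'I_n.+1
    (fun i => opX _ ^+ rev_ord i * oplift Q).
  move=> i; rewrite dcoefs_opXnM.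
  apply: leq_trans (size_iter_dshift _ (leqnn _)) _.
  by rewrite szQ addnC addSnnS leq_add2l ltn_ord.
have [|Y [N' NP]] := @div_rows _ n.+1 AP (p^-1)%:P size_AP bA 1 'I_n.+1
    (fun i => opX _ * opX _ ^+ rev_ord i).
  by move=> i; rewrite -exprS dcoefs_opXn size_polyXn add1n !ltnS -ltnS ltn_ord.
pose M := \matrix_i M' i; pose N := \matrix_i N' i.
have {}MP i : opX _ ^+ rev_ord i * oplift Q = rowop (X i) * AP + rowop (row i M).
  by rewrite rowK.
have eqM i : eqmod AP (opX _ ^+ rev_ord i * oplift Q) (rowop (row i M)).
  by exists (rowop (X i)).
have eqN i : eqmod AP (opX _ * opX _ ^+ rev_ord i) (rowop (row i N)).
  by exists (rowop (Y i)); rewrite rowK.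
have [chi echi] := constant_bipoly (der_char_poly size_AP bA AQ eqM eqN).
have chi_monic : chi \is monic.
  have := char_poly_monic M; rewrite echi !monicE !lead_coefE size_bivar_val.
  rewrite coef_map => /eqP e; apply/eqP.
  by apply: (map_inj_poly (@cval_inj F) (rmorph0 _)); rewrite rmorph1.
exists (p ^+ m.+1 * (-1) ^+ n.+1), chi; split.
- by split=> //; rewrite mulf_neq0 ?expf_neq0 // oppr_eq0 oner_eq0.
- rewrite minus_lambdaE minus_muE.
  rewrite (dres_char_poly dorder_AP _ _ MP) ?dorder_oplift // echi.
  by rewrite lead_AP [in RHS]polyCM !polyC_exp polyCN polyC1.
- rewrite -eval_PQ_bivar // /eval_PQ /eval_mu; rewrite -[bivar_val chi]echi.
  have [W ->] := char_poly_eval AQ eqM.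
  by rewrite addr0 opev_mul_root.
move=> g; rewrite -(eval_PQ_bivar PQ) => /eval_mu_mod[W eW].
have g0 : horner_mx M (bivar_val g) = 0.
  apply: (annihilates_companion size_AP bA AQ eqM (der_bivar_val g)).
  by exists W; rewrite addr0.
have [k ek] := char_poly_dvd_annihilator g0.
exists n.+1; apply: (@bivar_val_dvd _ chi _ k chi_monic).
by rewrite rmorphXn /= ek echi.
Qed.

(** After division by the monic [d], an element [r] of the kernel of degree less
    than that of [d] is a relation over [F] between the operators [P ^ i * Q ^ j],
    which commute with [P]. A nonzero [r] would give a nonzero relation over the
    constants of the same shape, a nonzero multiple of [d] of smaller degree. *)
Lemma elim_ideal_principal (d : bipoly C) (u : bipoly F) : d \is monic ->
  (forall g, op_eval P Q g = 0 <-> exists q, g = q * d) ->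
  eval_PQ P Q u = 0 <-> exists q, u = q * bivar_val d.
Proof.
move=> md kerd; have d0 : eval_PQ P Q (bivar_val d) = 0.
  by rewrite eval_PQ_bivar //; apply/kerd; exists 1; rewrite mul1r.
split=> [u0|[q ->]]; last exact: eval_PQ_mull.
have mbd := bivar_val_monic md.
have eu := Pdiv.RingMonic.rdivp_eq mbd u.
set q := Pdiv.Ring.rdivp u _ in eu; set r := Pdiv.Ring.rmodp u _ in eu.
exists q; suff r0 : r = 0 by rewrite {1}eu r0 addr0.
have szr : (size r < size d)%N.
  by rewrite -size_bivar_val Pdiv.Ring.ltn_rmodpN0 // monic_neq0.
have er : eval_PQ P Q r = 0.
  have -> : r = u - q * bivar_val d by rewrite {1}eu addrC addKr.
  by rewrite raddfB /= u0 (eval_PQ_mull PQ) // subr0.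
clearbody r; pose N := \max_(j < size r) size (r`_j)%R.
have szrj j : (size (r`_j)%R <= N)%N.
  have [le|lt] := leqP (size r) j; first by rewrite nth_default // size_poly0.
  by rewrite (leq_bigmax (Ordinal lt)).
move: er; rewrite (eval_PQ_wide PQ (leqnn _) szrj).
pose I : finType := ('I_(size r) * 'I_N)%type.
pose X (ji : I) := P ^+ ji.2 * Q ^+ ji.1.
pose a (ji : I) := r`_(ji.1)`_(ji.2).
move=> er; apply/eqP; apply: contraT => r0.
have [|||c [ec [[j0 i0] _ cji]]] := @centralizer_free F charC P n sizeP I setT X a.
- move=> i _; apply: commrM; apply: commrX => //.
- by rewrite -[RHS]er; apply: eq_bigl => i; rewrite inE.
- have [j rj] : exists j : 'I_(size r), r`_j != 0 by apply: poly_neq0_coef.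
  have [i rji] := poly_neq0_coef rj.
  by exists (j, Ordinal (leq_trans (ltn_ord i) (szrj j))).
pose g : bipoly C := rVpoly (\row_j rVpoly (\row_i c (j, i))).
have coef_g j i : g`_(j : 'I_(size r))`_(i : 'I_N) = c (j, i).
  by rewrite coef_rVpoly_ord mxE coef_rVpoly_ord mxE.
have szg : (size g <= size r)%N by apply: size_poly.
have [q1 eg] : exists q, g = q * d.
  apply/kerd; rewrite -eval_PQ_bivar // (@eval_PQ_wide _ _ _ PQ (size r) N).
  - rewrite -[RHS]ec; apply: eq_big => [i|[j i] _]; first by rewrite inE.
    by rewrite coef_bivar_val coef_g.
  - by rewrite size_bivar_val.
  move=> j; rewrite coef_map; apply: leq_trans (size_poly _ _) _.
  have [le|lt] := leqP (size r) j; first by rewrite nth_default ?size_poly0 ?(leq_trans szg).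
  by rewrite -[j]/(val (Ordinal lt)) coef_rVpoly_ord mxE size_poly.
case/negP: cji; rewrite -coef_g; suff -> : g = 0 by rewrite !coef0.
apply/eqP; apply: contraTT szr => g0; rewrite -leqNgt (leq_trans _ szg) //.
by apply: dvdp_leq => //; rewrite eg dvdp_mull.
Qed.

End SpectralCurve.

Theorem theorem4p8 (F : diffFieldType)
    (closedC : GRing.closed_field_axiom (constants F))
    (charC : [pchar (constants F)] =i pred0)
    (P Q : diffop F)
    (ncP : ~ const_coefs P) (ncQ : ~ const_coefs Q)
    (PQ : P * Q = Q * P)
    (ordP : (0 < dorder P)%N) (ordQ : (0 < dorder Q)%N) :
  let A := minus_lambda P in
  let B := minus_mu Q in
  let h : bipoly F := dres A B in
  (exists f, const_square_free_part h f) /\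
  forall f, const_square_free_part h f ->
    ((forall g, radical (elim_idealC A B) g <-> BC P Q g) /\
     (forall g, BC P Q g <-> principal_ideal f g)) /\
    (forall g, radical (elim_ideal A B) g <-> gen_dideal (bivar_val f) g).
Proof.
case ordP' : (dorder P) ordP => [//|n] _; case ordQ' : (dorder Q) ordQ => [//|m] _.
have [a [chi [[a_neq0 chi_monic] eh chi0 ker_chi]]] :=
  resultant_char_poly PQ ordP' ordQ'.
have [d [d_monic d_irr d_prime kerd [w [e [uw e_gt0 echi]]]]] :=
  @ker_principal (constants F) (diffop F) closedC
    (@op_eval F P Q) (@diffop_domain F) chi chi_monic chi0 ker_chi.
move=> A B h; rewrite {}/h {}/A {}/B; split.
  exists d, a, chi; split=> //.
  by rewrite echi; apply: square_free_part_prime_power.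
move=> f [a' [h0 [a'0 eh' sqf]]].
have [c [uc eh0]] : exists c, c \is a GRing.unit /\ h0 = c * chi.
  have e0 : a%:P%:P * bivar_val chi =
    a'%:P%:P * bivar_val h0 by rewrite -eh -eh'.
  (* As [chi] is monic, the constant [c] can be read off at its leading monomial. *)
  pose c := h0`_(size chi).-1`_0.
  have ec : a = a' * cval c.
    have := congr1 (fun q : bipoly F => q`_(size chi).-1`_0) e0.
    rewrite !mul_polyC !coefZ !mul_polyC !coefZ !coef_bivar_val -lead_coefE.
    by rewrite (monicP chi_monic) coef1 rmorph1 mulr1.
  have c0 : c != 0.
    by apply: contra a_neq0 => /eqP c0; rewrite ec c0 rmorph0 mulr0.
  exists c%:P%:P; split; first by rewrite !rmorph_unit // unitfE.
  apply: bivar_val_inj; apply: (@mulfI _ a'%:P%:P); first by rewrite !polyC_eq0.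
  rewrite -e0 ec !rmorphM /= -mulrA; congr (_ * (_ * _)).
  by rewrite /bivar_val map_polyC /= map_polyC.
have [v uv ef] : associated f d.
  apply: (@square_free_part_uniq _ d (c * w) f e d_prime) => //.
    by rewrite unitrMl.
  by rewrite -mulrA -echi -eh0.
have dvd_f g : (exists q, g = q * d) <-> (exists q, g = q * f).
  split=> [[q ->]|[q ->]]; last by exists (q * v); rewrite -mulrA ef.
  by exists (q / v); rewrite ef mulrA divrK.
have BC_elim g : BC P Q g <-> elim_idealC (minus_lambda P) (minus_mu Q) g.
  by rewrite /elim_idealC (elim_idealE PQ) (eval_PQ_bivar PQ).
split; [split|] => [g|g|u].
- rewrite BC_elim; split=> [[k _]|Eg]; last by exists 1%N; rewrite ?expr1.
  rewrite -!BC_elim /BC rmorphXn; elim: k => [|k IH].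
    by rewrite expr0 => /eqP; rewrite oner_eq0.
  by rewrite exprS => /diffop_domain[].
- by rewrite /BC kerd dvd_f.
rewrite gen_dideal_constant.
have -> : (exists q, u = q * bivar_val f) <-> (exists q, u = q * bivar_val d).
  have ubv : bivar_val v \is a GRing.unit.
    by apply/unitrPr; exists (bivar_val v^-1); rewrite -rmorphM /= divrr // rmorph1.
  rewrite ef rmorphM /=; split=> [[q ->]|[q ->]].
    by exists (q * bivar_val v); rewrite mulrA.
  by exists (q / bivar_val v); rewrite mulrA divrK.
split=> [[k _]|].
  rewrite (elim_idealE PQ) (elim_ideal_principal charC PQ ordP' _ d_monic kerd) => -[q eq].
  have d_sep := ker_generator_separable (@diffop_domain F) d_monic kerd.
  have bd_monic := bivar_val_monic d_monic.
  have /(Pdiv.IdomainMonic.dvdpP bd_monic)[q' ->] : bivar_val d %| u; last by exists q'.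
  apply: (@dvdp_exp_separable _ _ _ k); rewrite ?monic_neq0 //; last first.
    by rewrite eq dvdp_mull.
  apply: coprimep_deriv_map; last first.
    by apply: d_sep => j; have /pcharf0P-> := charC.
  by apply: map_inj_poly; [apply: cval_inj | apply: rmorph0].
move=> du; exists 1%N => //; rewrite expr1 (elim_idealE PQ).
by apply/(elim_ideal_principal charC PQ ordP' _ d_monic kerd).
Qed.
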